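(* There exists an absolute constant $C>0$ such that the following holds. Let $\mathcal D$ be any distribution on $[0,1]\times\{0,1\}$, let $T\ge 2$, and let $S$ be the uniform distribution over $T$ data points $(p_1,y_1),\ldots,(p_T,y_T)$ drawn i.i.d. from $\mathcal D$. Then $$\mathbb E\,|\mathsf{SCDL}(S)-\mathsf{SCDL}(\mathcal D)|\le C\,T^{-1/2}\log^{3/2}T .$$ Moreover, if $\mathsf{SCDL}(\mathcal D)=0$, then $\mathbb E[\mathsf{SCDL}(S)]\le C\,T^{-1/2}\log T$.
   Context: For $x\in\mathbb R$ write $x_+=\max\{x,0\}$. Let $\mathcal D$ be a probability distribution of pairs $(p,y)\in[0,1]\times\{0,1\}$. For a positive integer $m$ and $i\in\{0,\ldots,m\}$ let $w_i(p)=(1-|mp-i|)_+$, $\pi_i=\mathbb E_{(p,y)\sim\mathcal D}[w_i(p)]$ and $q_i=\mathbb E_{(p,y)\sim\mathcal D}[w_i(p)y]/\pi_i$. Equivalently, $p$ is randomly rounded to $p'\in\{0,1/m,\ldots,1\}$ with $\Pr[p'=i/m\mid p]=w_i(p)$ (rounding to one of the two nearest multiples of $1/m$ so that $\mathbb E[p'\mid p]=p$), and $\pi_i=\Pr[p'=i/m]$, $q_i=\mathbb E[y\mid p'=i/m]$; terms with $\pi_i=0$ are taken to be $0$. Define $$\mathsf{SCDL}_m(\mathcal D)=\max_{i=0,\ldots,m}\Big(\sum_{j=0}^{i}\pi_j\big(q_j-\tfrac{i+1}{m}\big)_+ +\sum_{j=i+1}^{m}\pi_j\big(\tfrac im-q_j\big)_+\Big),$$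 and $\mathsf{SCDL}(\mathcal D)=\inf_{m\in\{2^1,2^2,\ldots\}}\max\{\mathsf{SCDL}_m(\mathcal D),1/m\}$. Expectations are over the random sample. *)

(* Defs.v *)
From HB Require Import structures.
From mathcomp Require Import all_boot all_order all_algebra.
From mathcomp Require Import all_classical all_reals all_analysis.
From mathcomp Require Import Rstruct Rstruct_topology.
Set Implicit Arguments. Unset Strict Implicit. Unset Printing Implicit Defensive.
Import Order.TTheory GRing.Theory Num.Theory.
Local Open Scope ring_scope.
Local Open Scope classical_set_scope.

Definition RR : realType := Rdefinitions.R.

Notation datapt := (RR * bool)%type.

Definition posp (x : RR) : RR := Num.max x 0.

Definition wgt (m i : nat) (p : RR) : RR := posp (1 - `|m%:R * p - i%:R|).

(* SCDL_m of a distribution, given through its expectation operator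
   E f = E_{(p,y) ~ distribution}[f (p,y)].
   pi_j = E[w_j(p)], q_j = E[w_j(p) y] / pi_j   (x / 0 = 0 in MathComp, so a term
   with pi_j = 0 contributes pi_j * (...) = 0, as in the paper). *)
Definition SCDLm (E : (datapt -> RR) -> RR) (m : nat) : RR :=
  let pi := fun j : nat => E (fun z => wgt m j z.1) in
  let q := fun j : nat => E (fun z => wgt m j z.1 * (z.2)%:R) / pi j in
  \big[Num.max/0]_(i < m.+1)
     ( \sum_(j < m.+1 | (j <= i)%N) pi j * posp (q j - (i.+1)%:R / m%:R)
     + \sum_(j < m.+1 | (i < j)%N) pi j * posp (i%:R / m%:R - q j)).

Definition SCDL (E : (datapt -> RR) -> RR) : RR :=
  inf [set x : RR | exists k : nat,
         x = Num.max (SCDLm E (2 ^ k.+1)%N) ((2 ^ k.+1)%N%:R)^-1].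

Definition Expect_dist (D : probability datapt RR) (f : datapt -> RR) : RR :=
  fine (\int[D]_z (f z)%:E)%E.

Definition Expect_emp (T : nat) (z : 'I_T -> datapt) (f : datapt -> RR) : RR :=
  (T%:R)^-1 * \sum_(j < T) f (z j).

Definition mutually_independent (d : measure_display) (Omega : measurableType d)
  (P : probability Omega RR) (T : nat) (Z : 'I_T -> Omega -> datapt) : Prop :=
  forall A : 'I_T -> set datapt, (forall j, measurable (A j)) ->
    P (\bigcap_(j in [set: 'I_T]) (Z j @^-1` A j)) = (\prod_(j < T) P (Z j @^-1` A j))%E.

(* Main.v *)
(** SCDL_m is nondecreasing along m = 2, 4, 8, ...: rounding to multiples of 1/m
    factors through rounding to multiples of 1/(2m), and t |-> max(t,0) is convex.
    Since 1/m decreases, SCDL is determined by the scale m where the two cross,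
    and there SCDL_m(D) = O(1/m); scales m >> sqrt T / log T may be ignored.

    At such a scale, Bernstein's inequality for the signed cell masses
    E[w_j (y - (i+1)/m)] is used with a free parameter lambda: the deviation is at
    most 2 lambda pi_j + x / (lambda T).  A cell j at distance r from the threshold
    i is either far, i.e. q_j is below the threshold by r/(4m), and then
    lambda = r/(8m) makes the margin absorb the first term; or it is near, and then
    lambda ~ r sqrt(log T / T).  Because SCDL_m(D) = O(1/m), the near cells satisfy
    sum_j pi_j r_j = O(log m).  Summing the harmonic series over r gives the rate
    T^(-1/2) log^(3/2) T; when SCDL(D) = 0 there are no near cells with r > 0, which
    saves a factor sqrt(log T). *)
Require Import Defs.
From HB Require Import structures.
From mathcomp Require Import all_boot all_order all_algebra.
From mathcomp Require Import all_classical all_reals all_analysis.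
From mathcomp Require Import Rstruct Rstruct_topology measurable_realfun.
From mathcomp Require Import ring lra zify.
Set Implicit Arguments. Unset Strict Implicit. Unset Printing Implicit Defensive.
Import Order.TTheory GRing.Theory Num.Theory.
Local Open Scope ring_scope.
Local Open Scope classical_set_scope.

(** * Positive parts and one-sided deviation sums *)

Lemma posp_ge0 (x : RR) : 0 <= posp x.
Proof. by rewrite /posp le_max lexx orbT. Qed.

Lemma posp_ge (x : RR) : x <= posp x.
Proof. by rewrite /posp le_max lexx. Qed.

Lemma posp_le (x y : RR) : x <= y -> 0 <= y -> posp x <= y.
Proof. by move=> xy y0; rewrite /posp ge_max xy y0. Qed.

Lemma posp_eq0 (x : RR) : x <= 0 -> posp x = 0.
Proof. by move=> x0; rewrite /posp max_r. Qed.

Lemma pospM (c x : RR) : 0 <= c -> c * posp x = posp (c * x).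
Proof. by move=> c0; rewrite /posp maxr_pMr// mulr0. Qed.

(** Here [a j] stands for pi_j q_j. Multiplying a summand of SCDL_m through by pi_j removes the
    quotient and leaves an argument of [posp] that is linear in the distribution. *)
Definition lowdev (m : nat) (pi a : nat -> RR) (i : nat) : RR :=
  \sum_(0 <= j < i.+1) posp (a j - pi j * (i.+1%:R / m%:R)).

Definition highdev (m : nat) (pi a : nat -> RR) (i : nat) : RR :=
  \sum_(i.+1 <= j < m.+1) posp (pi j * (i%:R / m%:R) - a j).

Lemma lowdev_ge0 m pi a i : 0 <= lowdev m pi a i.
Proof. by apply: sumr_ge0 => j _; exact: posp_ge0. Qed.

Definition refl_seq (m : nat) (f : nat -> RR) : nat -> RR := fun j => f (m - j)%N.

(* Exchanging y with 1 - y and p with 1 - p swaps the two sums of SCDL_m. *)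
Lemma highdev_refl (m : nat) (pi a : nat -> RR) (i : nat) : (i < m)%N ->
  highdev m pi a i =
  lowdev m (refl_seq m pi) (refl_seq m (fun j => pi j - a j)) (m.-1 - i).
Proof.
move=> im; rewrite /highdev /lowdev -{1}[i.+1]add0n big_addn big_nat_rev /=.
rewrite (_ : (m.-1 - i).+1 = m.+1 - i.+1)%N; last by lia.
apply: eq_big_nat => j /andP[_ jm]; rewrite /refl_seq.
rewrite (_ : 0 + _ - _ + _ = m - j)%N; last by lia.
congr posp.
have -> : (m.+1 - i.+1)%:R = m%:R - i%:R :> RR by rewrite subSS natrB// ltnW.
have m0 : m%:R != 0 :> RR by rewrite pnatr_eq0; lia.
by field.
Qed.

(** * Harmonic sums and perturbation of the lower sums *)

(** Dyadic blocks: the 2^K terms of a block are each at most 2^-K, so each block adds at most 1. *)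
Lemma harmonic_le (n K : nat) : (n < 2 ^ K)%N ->
  \sum_(0 <= r < n) (r.+1%:R^-1 : RR) <= K%:R.
Proof.
move=> nK; apply: (@le_trans _ _ (\sum_(0 <= r < (2 ^ K).-1) (r.+1%:R^-1 : RR))).
  have nK' : (n <= (2 ^ K).-1)%N by lia.
  rewrite (big_cat_nat (leq0n n) nK') /= lerDl; apply: sumr_ge0 => r _.
  by rewrite invr_ge0.
elim: K {nK} => [|K IH]; first by rewrite expn0 big_geq.
have K0 : (0 < 2 ^ K)%N by rewrite expn_gt0.
have le2 : ((2 ^ K).-1 <= (2 ^ K.+1).-1)%N by rewrite expnS; lia.
rewrite (big_cat_nat (leq0n _) le2) /= -natr1; apply: lerD => //.
apply: (@le_trans _ _ (\sum_((2 ^ K).-1 <= r < (2 ^ K.+1).-1) ((2 ^ K)%:R^-1 : RR))).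
  apply: ler_sum_nat => r /andP[r1 _]; rewrite lef_pV2 ?posrE ?ltr0n//.
  by rewrite ler_nat; lia.
rewrite big_const_nat iter_addr_0 (_ : _ - _ = 2 ^ K)%N; last by rewrite expnS; lia.
by rewrite -[X in X <= _]mulr_natr mulVf// pnatr_eq0; lia.
Qed.

Lemma harmonic_rev_le (n K : nat) : (n < 2 ^ K)%N ->
  \sum_(0 <= j < n) ((n - j)%:R^-1 : RR) <= K%:R.
Proof.
move=> nK; apply: (le_trans _ (harmonic_le nK)); rewrite big_nat_rev /=.
by apply: ler_sum_nat => r /andP[_ rn]; rewrite (_ : n - _ = r.+1)%N//; lia.
Qed.

(* Cell j counts as near threshold i when q_j exceeds (i+1)/m - (i-j)/(4m). *)
Definition near_cell (m : nat) (pi a : nat -> RR) (i j : nat) : bool :=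
  pi j * (i.+1%:R / m%:R - (i - j)%:R / (4 * m%:R)) < a j.

(* A near cell j with 2^b <= i - j < 2^(b+1) contributes at least
   pi_j (i-j)/(4m) to the lower sum at threshold i - 2^b. *)
Lemma near_cell_mass (m : nat) (pi a : nat -> RR) (i K : nat) (s : RR) :
  (0 < m)%N -> (forall j, 0 <= pi j) -> 0 <= s -> (i < 2 ^ K)%N ->
  (forall i', (i' < i)%N -> lowdev m pi a i' <= s) ->
  \sum_(0 <= j < i | near_cell m pi a i j) pi j * (i - j)%:R <= 4 * m%:R * s * K%:R.
Proof.
move=> m0 pi0 s0 iK low_s.
have mR : 0 < m%:R :> RR by rewrite ltr0n.
(* The summand of cell j in the lower sum at threshold i - 2^b, and 0 where there is none. *)
pose t b j := if (2 ^ b <= i)%N && (j < (i - 2 ^ b).+1)%N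
  then posp (a j - pi j * ((i - 2 ^ b).+1%:R / m%:R)) else 0 : RR.
have t0 b j : 0 <= t b j by rewrite /t; case: ifP => // _; exact: posp_ge0.
have ct j : (j < i)%N -> near_cell m pi a i j ->
    pi j * (i - j)%:R <= 4 * m%:R * \sum_(0 <= b < K) t b j.
  move=> ji nj; set r := (i - j)%N; set b := trunc_log 2 r.
  have /andP[br rb] : (2 ^ b <= r < 2 ^ b.+1)%N.
    by apply: trunc_log_bounds => //; rewrite /r; lia.
  have bK : (b < K)%N.
    have : (2 ^ b < 2 ^ K)%N by rewrite /r in br; lia.
    by rewrite ltn_exp2l.
  have tb : pi j * r%:R / (4 * m%:R) <= t b j.
    rewrite /t ifT; last by rewrite /r in br; apply/andP; split; lia.
    apply: le_trans (posp_ge _).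
    move: nj; rewrite /near_cell -/r => /ltW nj.
    apply: (@le_trans _ _ (pi j * (i.+1%:R / m%:R - r%:R / (4 * m%:R))
                           - pi j * ((i - 2 ^ b).+1%:R / m%:R))); last by lra.
    rewrite -mulrBr -mulrA ler_wpM2l//.
    have -> : (i - 2 ^ b).+1%:R = i.+1%:R - (2 ^ b)%:R :> RR.
      by rewrite -natrB; [congr (_%:R); rewrite /r in br; lia|rewrite /r in br; lia].
    (* Moving the threshold down by 2^b gains 2^b/m, at least r/(2m); nearness gives away at most
       r/(4m), so r/(4m) is left. *)
    have h : r%:R <= 2 * (2 ^ b)%:R :> RR.
      by rewrite -natrM ler_nat -expnS ltnW.
    have -> : i.+1%:R / m%:R - r%:R / (4 * m%:R) - (i.+1%:R - (2 ^ b)%:R) / m%:R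
      = (4 * (2 ^ b)%:R - r%:R) / (4 * m%:R) :> RR by field; rewrite gt_eqF.
    by rewrite ler_pM2r ?invr_gt0 ?mulr_gt0//; lra.
  rewrite -ler_pdivrMl ?mulr_gt0// mulrC; apply: le_trans tb _.
  rewrite (bigD1_seq b) ?iota_uniq//=; last by rewrite mem_index_iota.
  by rewrite lerDl; apply: sumr_ge0 => ? _.
apply: (@le_trans _ _ (\sum_(0 <= j < i) 4 * m%:R * \sum_(0 <= b < K) t b j)).
  rewrite big_mkcond; apply: ler_sum_nat => j /andP[_ ji].
  case: ifP => [nj|_]; first exact: ct.
  by rewrite !mulr_ge0// ?sumr_ge0.
rewrite -mulr_sumr -[X in _ <= X]mulrA ler_wpM2l ?mulr_ge0//.
(* For each of the K scales b, the sum over cells is part of a single lower sum, hence at most s. *)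
rewrite exchange_big /=.
apply: (@le_trans _ _ (\sum_(0 <= b < K) s)); last first.
  by rewrite big_const_nat iter_addr_0 subn0 mulr_natr.
apply: ler_sum_nat => b _.
have b0 : (0 < 2 ^ b)%N by rewrite expn_gt0.
case: (leqP (2 ^ b) i) => bi; last first.
  by rewrite big1// => j _; rewrite /t leqNgt bi.
apply: le_trans (low_s (i - 2 ^ b)%N _); last by lia.
rewrite /lowdev [leRHS](@big_nat_widen _ _ _ _ _ i) /=; last by lia.
rewrite [leRHS]big_mkcond /=; apply: ler_sum_nat => j _.
by rewrite /t bi.
Qed.

(** The Bernstein parameter [lam] is chosen cell by cell. For a far cell 2 [lam] pi_j is exactly the
    margin pi_j (i-j)/(4m), so only y / [lam] = 8my/(i-j) survives; near cells and the cell i itself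
    pay both terms. *)
Lemma lowdev_perturb (m : nat) (pi a pi' a' : nat -> RR) (i : nat) (th y : RR) :
  (0 < m)%N -> (forall j, 0 <= pi j) -> 0 < th -> 0 <= y ->
  (forall j, (j <= i)%N ->
     let lam := if j == i then th else
       if near_cell m pi a i j then th * (i - j)%:R else (i - j)%:R / (8 * m%:R) in
     (a' j - pi' j * (i.+1%:R / m%:R)) - (a j - pi j * (i.+1%:R / m%:R))
       <= 2 * lam * pi j + y / lam) ->
  lowdev m pi' a' i <= lowdev m pi a i + (2 * th * pi i + y / th)
   + \sum_(0 <= j < i | near_cell m pi a i j)
       (2 * th * (pi j * (i - j)%:R) + y / th * (i - j)%:R^-1)
   + 8 * m%:R * y * \sum_(0 <= j < i) ((i - j)%:R^-1 : RR).
Proof.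
move=> m0 pi0 th0 y0 dev.
have mR : 0 < m%:R :> RR by rewrite ltr0n.
have th0' := ltW th0.
rewrite /lowdev !big_nat_recr //=.
set c := i.+1%:R / m%:R.
have last_le : posp (a' i - pi' i * c) <= posp (a i - pi i * c) + (2 * th * pi i + y / th).
  have /= := dev i (leqnn i); rewrite eqxx -/c => d.
  have g0 : 0 <= 2 * th * pi i + y / th by rewrite addr_ge0// ?divr_ge0// !mulr_ge0// ?pi0.
  apply: posp_le; last by rewrite addr_ge0// posp_ge0.
  by have := posp_ge (a i - pi i * c); lra.
suff : \sum_(0 <= j < i) posp (a' j - pi' j * c) <=
   \sum_(0 <= j < i) posp (a j - pi j * c)
   + \sum_(0 <= j < i | near_cell m pi a i j)
       (2 * th * (pi j * (i - j)%:R) + y / th * (i - j)%:R^-1)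
   + 8 * m%:R * y * \sum_(0 <= j < i) ((i - j)%:R^-1 : RR) by lra.
rewrite mulr_sumr [X in _ + X + _]big_mkcond -!big_split /=.
apply: ler_sum_nat => j /andP[_ ji].
have /= := dev j (ltnW ji); rewrite (ltn_eqF ji) -/c => d.
have r0 : 0 < (i - j)%:R :> RR by rewrite ltr0n; lia.
have far0 : 0 <= 8 * m%:R * y * (i - j)%:R^-1 by rewrite !mulr_ge0// ?invr_ge0// ltW.
case: ifP d => nj d.
  have e : y / (th * (i - j)%:R) = y / th * (i - j)%:R^-1 by rewrite invfM mulrA.
  have e2 : 2 * (th * (i - j)%:R) * pi j = 2 * th * (pi j * (i - j)%:R) by ring.
  rewrite e e2 in d.
  have g1 : 0 <= 2 * th * (pi j * (i - j)%:R) by rewrite !mulr_ge0// ltW.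
  have g2 : 0 <= y / th * (i - j)%:R^-1 by rewrite !mulr_ge0// ?invr_ge0// ltW.
  apply: posp_le; last by have := posp_ge0 (a j - pi j * c); lra.
  by have := posp_ge (a j - pi j * c); lra.
rewrite addr0; apply: posp_le; last by rewrite addr_ge0// posp_ge0.
move: nj; rewrite /near_cell => /negbT; rewrite -leNgt mulrBr -/c => nj.
have e : y / ((i - j)%:R / (8 * m%:R)) = 8 * m%:R * y * ((i - j)%:R^-1 : RR).
  by field; rewrite !gt_eqF.
have e2 : 2 * ((i - j)%:R / (8 * m%:R)) * pi j = pi j * ((i - j)%:R / (4 * m%:R)).
  by field; rewrite gt_eqF.
rewrite e e2 in d.
by have := posp_ge0 (a j - pi j * c); lra.
Qed.

(** The near cells are paid for by [near_cell_mass], and both harmonic sums are at most K. *)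
Lemma lowdev_perturb_smooth (m : nat) (pi a pi' a' : nat -> RR) (i K : nat) (th y s : RR) :
  (0 < m)%N -> (forall j, 0 <= pi j <= 1) -> 0 < th -> 0 <= y -> 0 <= s ->
  (i < 2 ^ K)%N -> (forall i', (i' < i)%N -> lowdev m pi a i' <= s) ->
  (forall j, (j <= i)%N ->
     let lam := if j == i then th else
       if near_cell m pi a i j then th * (i - j)%:R else (i - j)%:R / (8 * m%:R) in
     (a' j - pi' j * (i.+1%:R / m%:R)) - (a j - pi j * (i.+1%:R / m%:R))
       <= 2 * lam * pi j + y / lam) ->
  lowdev m pi' a' i <= lowdev m pi a i
    + (2 * th * (1 + 4 * m%:R * s * K%:R) + y / th * (1 + K%:R) + 8 * m%:R * y * K%:R).
Proof.
move=> m0 pi01 th0 y0 s0 iK low_s dev.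
have pi0 j : 0 <= pi j by case/andP: (pi01 j).
have mR : 0 < m%:R :> RR by rewrite ltr0n.
have := lowdev_perturb m0 pi0 th0 y0 dev.
have := near_cell_mass m0 pi0 s0 iK low_s.
have H := harmonic_rev_le iK.
rewrite big_split /= -!mulr_sumr; set N := \sum_(_ <= _ < _ | _) _ => N_le.
set H' := \sum_(_ <= _ < _ | _) _.
have H'le : H' <= K%:R.
  apply: le_trans H; rewrite /H' big_mkcond /=; apply: ler_sum_nat => j _.
  by case: ifP => // _; rewrite invr_ge0.
have yt : 0 <= y / th by rewrite divr_ge0// ltW.
have h1 := ler_wpM2l yt H'le.
have h2 : 8 * m%:R * y * \sum_(0 <= j < i) ((i - j)%:R^-1 : RR) <= 8 * m%:R * y * K%:R.
  by rewrite ler_wpM2l// !mulr_ge0// ltW.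
have h3 : 2 * th * N <= 2 * th * (4 * m%:R * s * K%:R).
  by rewrite ler_wpM2l// mulr_ge0// ltW.
have h4 : 2 * th * pi i <= 2 * th.
  by rewrite ler_piMr ?mulr_ge0// ?(ltW th0)//; case/andP: (pi01 i).
lra.
Qed.

(* If the lower sums all vanish then q_j <= (j+1)/m, and no cell j < i is near i. *)
Lemma lowdev_perturb_calibrated (m : nat) (pi a pi' a' : nat -> RR) (i K : nat) (th y : RR) :
  (0 < m)%N -> (forall j, 0 <= pi j <= 1) -> 0 < th -> 0 <= y ->
  (i < 2 ^ K)%N -> (forall i', (i' <= i)%N -> lowdev m pi a i' <= 0) ->
  (forall j, (j <= i)%N ->
     let lam := if j == i then th else
       if near_cell m pi a i j then th * (i - j)%:R else (i - j)%:R / (8 * m%:R) in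
     (a' j - pi' j * (i.+1%:R / m%:R)) - (a j - pi j * (i.+1%:R / m%:R))
       <= 2 * lam * pi j + y / lam) ->
  lowdev m pi' a' i <= 2 * th + y / th + 8 * m%:R * y * K%:R.
Proof.
move=> m0 pi01 th0 y0 iK low_0 dev.
have pi0 j : 0 <= pi j by case/andP: (pi01 j).
have mR : 0 < m%:R :> RR by rewrite ltr0n.
have := lowdev_perturb m0 pi0 th0 y0 dev.
have H := harmonic_rev_le iK.
rewrite big_nat_cond big_pred0; last first.
  move=> j; apply/negP => /andP[/andP[_ ji]]; rewrite /near_cell.
  apply/negP; rewrite -leNgt.
  (* The last summand of the vanishing lower sum at j places q_j at least (i-j)/m below (i+1)/m,
     more than the margin (i-j)/(4m) that makes a cell far. *)
  have : posp (a j - pi j * (j.+1%:R / m%:R)) <= 0.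
    apply: le_trans (low_0 j (ltnW ji)).
    by rewrite /lowdev big_nat_recr//= lerDr sumr_ge0// => *; exact: posp_ge0.
  move=> /(le_trans (posp_ge _)); rewrite subr_le0 => /le_trans; apply.
  rewrite ler_wpM2l// (_ : i.+1%:R = j.+1%:R + (i - j)%:R); last first.
    by rewrite -natrD; congr (_%:R); lia.
  rewrite mulrDl -addrA lerDl subr_ge0 invfM mulrA ler_pM2r ?invr_gt0//.
  by rewrite ler_piMr// invf_le1//; lra.
have h2 : 8 * m%:R * y * \sum_(0 <= j < i) ((i - j)%:R^-1 : RR) <= 8 * m%:R * y * K%:R.
  by rewrite ler_wpM2l// !mulr_ge0// ltW.
have h4 : 2 * th * pi i <= 2 * th.
  by rewrite ler_piMr ?mulr_ge0// ?(ltW th0)//; case/andP: (pi01 i).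
have := low_0 i (leqnn i); lra.
Qed.

(** * Monotonicity when the grid is halved *)

(** Fine cell 2l+1 gives one half to coarse cell l and one half to l+1, so the odd cells below 2n
    are complete and only cell 2n+1 at the edge stays halved. *)
Lemma sum_refine_low (A : nat -> RR) (n : nat) :
  \sum_(0 <= l < n.+1) ((if l is l'.+1 then 2^-1 * A l'.*2.+1 else 0)
     + A l.*2 + 2^-1 * A l.*2.+1) =
  \sum_(0 <= j < n.*2.+1) A j + 2^-1 * A n.*2.+1.
Proof.
elim: n => [|n IH]; first by rewrite !big_nat1 add0r.
by rewrite big_nat_recr//= IH doubleS !big_nat_recr//=; lra.
Qed.

Lemma sum_refine_high (B : nat -> RR) (p q : nat) : (p < q)%N ->
  \sum_(p <= k < q) (2^-1 * B k.*2.+1 + B k.+1.*2 + 2^-1 * B k.+1.*2.+1) =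
  2^-1 * B p.*2.+1 + \sum_(p.*2.+2 <= j < q.*2.+1) B j + 2^-1 * B q.*2.+1.
Proof.
elim: q => // q IH; rewrite ltnS leq_eqVlt => /orP[/eqP ->|pq].
  by rewrite !doubleS !big_nat1.
rewrite big_nat_recr ?(ltnW pq)//= IH// doubleS.
rewrite [in RHS]big_nat_recr /=; last by lia.
rewrite [in RHS]big_nat_recr /=; last by lia.
lra.
Qed.

(** The recursion for coarse cell m reaches fine cell 2m+1, beyond the grid; the first clause says
    that it is empty. *)
Definition refines (m : nat) (f f' : nat -> RR) : Prop :=
  f' (m.*2.+1)%N = 0 /\
  forall l, (l <= m)%N ->
    f l = (if l is l'.+1 then 2^-1 * f' l'.*2.+1 else 0) + f' l.*2 + 2^-1 * f' l.*2.+1.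

Lemma posp_half_sum (x y z : RR) :
  posp (2^-1 * x + y + 2^-1 * z) <= 2^-1 * posp x + posp y + 2^-1 * posp z.
Proof.
have := posp_ge0 x; have := posp_ge0 y; have := posp_ge0 z.
have := posp_ge x; have := posp_ge y; have := posp_ge z => *.
by apply: posp_le; lra.
Qed.

(* Cells below 2i+1 are charged to both fine thresholds 2i and 2i+1, while cell 2i+1
   is split equally between a lower and an upper term: averaging the two fine
   thresholds reproduces exactly the coefficients of the rounding. *)
Lemma dev_refine (m : nat) (pi a pi' a' : nat -> RR) (i : nat) : (i < m)%N ->
  (forall j, 0 <= pi' j) -> refines m pi pi' -> refines m a a' ->
  lowdev m pi a i + highdev m pi a i <=
  2^-1 * (lowdev m.*2 pi' a' i.*2 + highdev m.*2 pi' a' i.*2) +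
  2^-1 * (lowdev m.*2 pi' a' i.*2.+1 + highdev m.*2 pi' a' i.*2.+1).
Proof.
move=> im pi0 [pim refpi] [am refa].
have mR : 0 < m%:R :> RR by rewrite ltr0n; lia.
have m2R : 0 < m.*2%:R :> RR by rewrite ltr0n; lia.
pose A j := posp (a' j - pi' j * (i.+1%:R / m%:R)).
pose B j := posp (pi' j * (i%:R / m%:R) - a' j).
have Blast : B m.*2.+1 = 0 by rewrite /B pim am mul0r subr0 posp_eq0.
have leA : lowdev m pi a i <= \sum_(0 <= j < i.*2.+1) A j + 2^-1 * A i.*2.+1.
  rewrite -sum_refine_low; apply: ler_sum_nat => l /andP[_ li].
  rewrite refpi ?refa; [|lia|lia].
  case: l li => [|l] li.
    apply: posp_le; last by rewrite add0r addr_ge0 ?mulr_ge0 ?posp_ge0.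
    have := posp_ge (a' 0.*2 - pi' 0.*2 * (i.+1%:R / m%:R)).
    have := posp_ge (a' 0.*2.+1 - pi' 0.*2.+1 * (i.+1%:R / m%:R)).
    by rewrite /A; lra.
  apply: le_trans (posp_half_sum _ _ _).
  by rewrite le_eqVlt; apply/orP; left; apply/eqP; congr posp; ring.
have leB : highdev m pi a i <= 2^-1 * B i.*2.+1 + \sum_(i.*2.+2 <= j < m.*2.+1) B j.
  have := sum_refine_high B im; rewrite Blast mulr0 addr0 => <-.
  rewrite /highdev -addn1 -[m.+1]addn1 big_addn addnK.
  apply: ler_sum_nat => l /andP[_ li]; rewrite addn1.
  rewrite refpi ?refa; [|lia|lia].
  apply: le_trans (posp_half_sum _ _ _).
  by rewrite le_eqVlt; apply/orP; left; apply/eqP; congr posp; ring.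
have pmono (x y : RR) : x <= y -> posp x <= posp y.
  by move=> xy; apply: posp_le (posp_ge0 _); exact: le_trans (posp_ge _).
have e1 : i.+1%:R / m%:R = i.*2.+2%:R / m.*2%:R :> RR.
  by rewrite -doubleS -!muln2 !natrM -mulf_div divff// mulr1.
have e2 : i%:R / m%:R = i.*2%:R / m.*2%:R :> RR.
  by rewrite -!muln2 !natrM -mulf_div divff// mulr1.
have e3 : i.*2.+1%:R / m.*2%:R <= i.*2.+2%:R / m.*2%:R :> RR.
  by rewrite ler_pM2r ?invr_gt0// ler_nat.
have e4 : i.*2%:R / m.*2%:R <= i.*2.+1%:R / m.*2%:R :> RR.
  by rewrite ler_pM2r ?invr_gt0// ler_nat.
(* The coarse lower threshold is the fine one at 2i+1 and lies above the one at 2i; the coarse upper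
   threshold is the fine one at 2i and lies below the one at 2i+1. Each replacement can only enlarge
   the terms. *)
have l1 : \sum_(0 <= j < i.*2.+1) A j <= lowdev m.*2 pi' a' i.*2.
  apply: ler_sum_nat => j _; rewrite /A e1; apply: pmono.
  by rewrite lerD2l lerN2 ler_wpM2l.
have l2 : \sum_(0 <= j < i.*2.+1) A j + A i.*2.+1 <= lowdev m.*2 pi' a' i.*2.+1.
  by rewrite -big_nat_recr//=; apply: ler_sum_nat => j _; rewrite /A e1.
have h1 : B i.*2.+1 + \sum_(i.*2.+2 <= j < m.*2.+1) B j <= highdev m.*2 pi' a' i.*2.
  rewrite -big_ltn /=; last by lia.
  by apply: ler_sum_nat => j _; rewrite /B e2.
have h2 : \sum_(i.*2.+2 <= j < m.*2.+1) B j <= highdev m.*2 pi' a' i.*2.+1.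
  apply: ler_sum_nat => j _; rewrite /B e2; apply: pmono.
  by rewrite lerD2r ler_wpM2l.
lra.
Qed.

(** * Bounded measurable functions and expectation operators *)

Definition bmeas (f : datapt -> RR) : Prop :=
  measurable_fun setT f /\ exists B : RR, forall z, `|f z| <= B.

Lemma bmeas_cst (c : RR) : bmeas (fun=> c).
Proof. by split; [exact: measurable_cst|exists `|c|]. Qed.

Lemma bmeasD (f g : datapt -> RR) : bmeas f -> bmeas g -> bmeas (fun z => f z + g z).
Proof.
move=> [mf [A fA]] [mg [B gB]]; split; first exact: measurable_funD.
by exists (A + B) => z; rewrite (le_trans (ler_normD _ _))// lerD.
Qed.

Lemma bmeasM (f g : datapt -> RR) : bmeas f -> bmeas g -> bmeas (fun z => f z * g z).
Proof.
move=> [mf [A fA]] [mg [B gB]]; split; first exact: measurable_funM.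
by exists (A * B) => z; rewrite normrM ler_pM.
Qed.

Lemma bmeasZ (c : RR) (f : datapt -> RR) : bmeas f -> bmeas (fun z => c * f z).
Proof. by move=> bf; apply: bmeasM => //; exact: bmeas_cst. Qed.

Lemma bmeasB (f g : datapt -> RR) : bmeas f -> bmeas g -> bmeas (fun z => f z - g z).
Proof.
move=> bf bg; have := bmeasD bf (bmeasZ (-1) bg).
by congr bmeas; apply/funext => z; rewrite mulN1r.
Qed.

Lemma bmeas_sum (n : nat) (f : nat -> datapt -> RR) : (forall j, bmeas (f j)) ->
  bmeas (fun z => \sum_(0 <= j < n) f j z).
Proof.
move=> bf; elim: n => [|n IH].
  have := bmeas_cst 0.
  by congr bmeas; apply/funext => z; rewrite big_geq.
have := bmeasD IH (bf n).
by congr bmeas; apply/funext => z; rewrite big_nat_recr.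
Qed.

Lemma wgt_ge0 m i p : 0 <= wgt m i p.
Proof. exact: posp_ge0. Qed.

Lemma wgt_le1 m i p : wgt m i p <= 1.
Proof. by apply: posp_le => //; rewrite gerBl. Qed.

Lemma measurable_wgt m i : measurable_fun setT (wgt m i).
Proof.
apply: measurable_maxr; last exact: measurable_cst.
apply: measurable_funB; first exact: measurable_cst.
apply: measurableT_comp; first exact: normr_measurable.
apply: measurable_funB; last exact: measurable_cst.
by apply: measurable_funM => //; exact: measurable_cst.
Qed.

Lemma bmeas_wgt m i : bmeas (fun z => wgt m i z.1).
Proof.
split; first by apply: measurableT_comp; [exact: measurable_wgt|exact: measurable_fst].
by exists 1 => z; rewrite ger0_norm ?wgt_ge0 ?wgt_le1.
Qed.

Lemma bmeas_label (b : bool) : bmeas (fun z => (z.2 (+) b)%:R).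
Proof.
split.
  rewrite (_ : (fun z => _) = (fun z : datapt => if z.2 then (~~ b)%:R else b%:R)); last first.
    by apply/funext => z; case: z.2.
  by apply: measurable_fun_ifT; [exact: measurable_snd|exact: measurable_cst|exact: measurable_cst].
by exists 1 => z; case: (_ (+) _); rewrite ?normr0 ?normr1.
Qed.

(** A common interface for integration against D and for the sample average, so that facts about
    SCDL are proved once. Bounded measurable functions are integrable, which makes the integral
    linear on them. *)
Record is_expectation (E : (datapt -> RR) -> RR) : Prop := {
  expect_lin : forall c f g, bmeas f -> bmeas g ->
    E (fun z => f z + c * g z) = E f + c * E g;
  expect_mono : forall f g, bmeas f -> bmeas g -> (forall z, f z <= g z) -> E f <= E g;
  expect1 : E (fun=> 1) = 1 }.

(** Concentration on p in [0,1], expressed through the operator. The refinement identities for the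
    weights hold only there. *)
Definition unit_supported (E : (datapt -> RR) -> RR) : Prop :=
  forall f g, bmeas f -> bmeas g -> (forall z, 0 <= z.1 <= 1 -> f z = g z) -> E f = E g.

Section Expectation.
Variable E : (datapt -> RR) -> RR.
Hypothesis Eexp : is_expectation E.

Lemma expectD f g : bmeas f -> bmeas g -> E (fun z => f z + g z) = E f + E g.
Proof.
move=> bf bg; rewrite -[in RHS](mul1r (E g)) -expect_lin//.
by congr E; apply/funext => z; rewrite mul1r.
Qed.

Lemma expectB f g : bmeas f -> bmeas g -> E (fun z => f z - g z) = E f - E g.
Proof.
move=> bf bg; rewrite -[in RHS](mulN1r (E g)) -expect_lin//.
by congr E; apply/funext => z; rewrite mulN1r.
Qed.

Lemma expect0 : E (fun=> 0) = 0.
Proof.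
have := expect_lin Eexp (-1) (bmeas_cst 1) (bmeas_cst 1).
rewrite (expect1 Eexp) => h; transitivity (1 + -1 * 1 : RR); last by rewrite mulN1r subrr.
by rewrite -h; congr E; apply/funext => z; rewrite mulN1r subrr.
Qed.

Lemma expectZ c f : bmeas f -> E (fun z => c * f z) = c * E f.
Proof.
move=> bf; rewrite -[RHS]add0r -expect0 -expect_lin//; last exact: bmeas_cst.
by congr E; apply/funext => z; rewrite add0r.
Qed.

Lemma expect_sum (n : nat) (f : nat -> datapt -> RR) : (forall j, bmeas (f j)) ->
  E (fun z => \sum_(0 <= j < n) f j z) = \sum_(0 <= j < n) E (f j).
Proof.
move=> bf; elim: n => [|n IH].
  rewrite [RHS]big_geq//; transitivity (E (fun=> 0)); last exact: expect0.
  by congr E; apply/funext => z; rewrite big_geq.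
rewrite big_nat_recr//= -IH -expectD//; last exact: bmeas_sum.
by congr E; apply/funext => z; rewrite big_nat_recr.
Qed.

Lemma expect_ge0 f : bmeas f -> (forall z, 0 <= f z) -> 0 <= E f.
Proof.
move=> bf f0; apply: (@le_trans _ _ (E (fun=> 0))); first by rewrite expect0.
by apply: expect_mono => //; exact: bmeas_cst.
Qed.

Lemma expect_le1 f : bmeas f -> (forall z, f z <= 1) -> E f <= 1.
Proof.
by move=> bf f1; rewrite -(expect1 Eexp); apply: expect_mono => //; exact: bmeas_cst.
Qed.

End Expectation.

(* With side = true, p and y are replaced by 1 - p and 1 - y. *)
Definition cell_wgt (side : bool) (m j : nat) (z : datapt) : RR :=
  wgt m (if side then (m - j)%N else j) z.1.

Definition cell_mass (E : (datapt -> RR) -> RR) side m j : RR := E (cell_wgt side m j).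

Definition cell_pos (E : (datapt -> RR) -> RR) (side : bool) m j : RR :=
  E (fun z => cell_wgt side m j z * (z.2 (+) side)%:R).

Definition cell_test (side : bool) (m i j : nat) (z : datapt) : RR :=
  cell_wgt side m j z * ((z.2 (+) side)%:R - i.+1%:R / m%:R).

Lemma cell_wgt_ge0 side m j z : 0 <= cell_wgt side m j z.
Proof. exact: wgt_ge0. Qed.

Lemma cell_wgt_le1 side m j z : cell_wgt side m j z <= 1.
Proof. exact: wgt_le1. Qed.

Lemma bmeas_cell_wgt side m j : bmeas (cell_wgt side m j).
Proof. exact: bmeas_wgt. Qed.

Lemma bmeas_cell_test side m i j : bmeas (cell_test side m i j).
Proof.
apply: bmeasM; first exact: bmeas_cell_wgt.
by apply: bmeasB; [exact: bmeas_label|exact: bmeas_cst].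
Qed.

Lemma cell_test_norm side m i j z : (i < m)%N ->
  `|cell_test side m i j z| <= cell_wgt side m j z.
Proof.
move=> im; rewrite normrM ger0_norm ?cell_wgt_ge0// ler_piMr ?cell_wgt_ge0//.
have mR : 0 < m%:R :> RR by rewrite ltr0n; lia.
have c0 : 0 <= i.+1%:R / m%:R :> RR by rewrite divr_ge0.
have c1 : i.+1%:R / m%:R <= 1 :> RR by rewrite ler_pdivrMr// mul1r ler_nat.
set c := _ / _ in c0 c1 *; rewrite ler_norml.
case: (_ (+) _); rewrite /= ?mulr0n ?mulr1n; apply/andP; split; lra.
Qed.

(** After taking expectations this bounds the second moment by pi_j, which makes the Bernstein error
    of a cell proportional to its mass. *)
Lemma cell_test_sqr side m i j z : (i < m)%N ->
  cell_test side m i j z ^+ 2 <= cell_wgt side m j z.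
Proof.
move=> im; have := cell_test_norm side j z im => h.
rewrite -real_normK ?num_real// expr2; apply: le_trans h.
by rewrite ler_piMr//; apply: le_trans (cell_test_norm side j z im) (cell_wgt_le1 _ _ _ _).
Qed.

(** * Hat functions: partition of unity and two-scale relation *)

Definition unit_clamp (x : RR) : RR := Num.min (posp x) 1.

Lemma pospP (x : RR) : (x <= 0 /\ posp x = 0) \/ (0 <= x /\ posp x = x).
Proof.
by rewrite /posp; have [x0|x0] := leP x 0; [left|right; rewrite ltW].
Qed.

Lemma normrP (x : RR) : (0 <= x /\ `|x| = x) \/ (x < 0 /\ `|x| = - x).
Proof. by have [x0|x0] := leP 0 x; [left; rewrite ger0_norm|right; rewrite ltr0_norm]. Qed.

Lemma unit_clampP (x : RR) : [\/ x <= 0 /\ unit_clamp x = 0,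
  0 <= x <= 1 /\ unit_clamp x = x | 1 <= x /\ unit_clamp x = 1].
Proof.
rewrite /unit_clamp; have [[x0 ->]|[x0 ->]] := pospP x.
  by constructor 1; rewrite min_l.
have [x1|x1] := leP x 1; first by constructor 2; rewrite x0.
by constructor 3; rewrite ltW.
Qed.

(* The hat function telescopes: it is a difference of two consecutive clamps. *)
Lemma hat_clamp (u : RR) : posp (1 - `|u|) = unit_clamp (u + 1) - unit_clamp u.
Proof.
have [[? ->]|[/andP[? ?] ->]|[? ->]] := unit_clampP (u + 1);
have [[? ->]|[/andP[? ?] ->]|[? ->]] := unit_clampP u;
have [[? ->]|[? ->]] := pospP (1 - `|u|); have [[? ?]|[? ?]] := normrP u; lra.
Qed.

(** By [hat_clamp] the sum telescopes to a difference of two values of [unit_clamp], both in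
    [0,1]. *)
Lemma sum_hat_le1 (u : RR) (n : nat) :
  \sum_(0 <= j < n) posp (1 - `|u + j%:R|) <= 1.
Proof.
have -> : \sum_(0 <= j < n) posp (1 - `|u + j%:R|) =
    unit_clamp (u + n%:R) - unit_clamp (u + 0%:R).
  rewrite -(telescope_sumr (fun j => unit_clamp (u + j%:R)))//.
  by apply: eq_big_nat => j _; rewrite hat_clamp -addrA natr1.
have c0 x : 0 <= unit_clamp x by rewrite le_min posp_ge0 ler01.
have c1 x : unit_clamp x <= 1 by rewrite ge_min lexx orbT.
by have := c0 (u + 0%:R); have := c1 (u + n%:R); lra.
Qed.

Lemma sum_cell_wgt_le1 side m n z : (n <= m.+1)%N ->
  \sum_(0 <= j < n) cell_wgt side m j z <= 1.
Proof.
move=> nm; case: side; rewrite /cell_wgt /wgt /=.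
  apply: le_trans (sum_hat_le1 (m%:R * z.1 - m%:R) n).
  apply: ler_sum_nat => j /andP[_ jn]; rewrite natrB; last by lia.
  by rewrite (_ : _ - (m%:R - j%:R) = m%:R * z.1 - m%:R + j%:R)//; ring.
apply: le_trans (sum_hat_le1 (- (m%:R * z.1)) n).
by apply: ler_sum_nat => j _; rewrite distrC [j%:R - _]addrC.
Qed.

(** A ramp over [0,1] is made of two ramps of height 1/2, over [0,1/2] and [1/2,1]. Used at u and u
    + 1 it yields the two-scale relation of the hat. *)
Lemma unit_clamp_double (x : RR) :
  unit_clamp x = 2^-1 * (unit_clamp (2 * x) + unit_clamp (2 * x - 1)).
Proof.
have [[? ->]|[/andP[? ?] ->]|[? ->]] := unit_clampP x;
have [[? ->]|[/andP[? ?] ->]|[? ->]] := unit_clampP (2 * x); try lra;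
have [[? ->]|[/andP[? ?] ->]|[? ->]] := unit_clampP (2 * x - 1); lra.
Qed.

Lemma hat_refine (u : RR) : posp (1 - `|u|) =
  2^-1 * posp (1 - `|2 * u + 1|) + posp (1 - `|2 * u|) + 2^-1 * posp (1 - `|2 * u - 1|).
Proof.
rewrite !hat_clamp (unit_clamp_double (u + 1)) (unit_clamp_double u).
rewrite (_ : 2 * (u + 1) = 2 * u + 1 + 1); last by ring.
rewrite addrK subrK; lra.
Qed.

Lemma wgt_refine m l (p : RR) : 0 <= p <= 1 ->
  wgt m l p = (if l is l'.+1 then 2^-1 * wgt m.*2 l'.*2.+1 p else 0)
     + wgt m.*2 l.*2 p + 2^-1 * wgt m.*2 l.*2.+1 p.
Proof.
move=> /andP[p0 p1]; rewrite /wgt hat_refine.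
have mp0 : 0 <= m%:R * p by rewrite mulr_ge0.
rewrite -[m.*2]muln2 natrM; congr (_ + _ + _); last first.
- by congr (_ * posp (1 - `|_|)); rewrite -[l.*2.+1%:R]natr1 -[l.*2]muln2 natrM; ring.
- by congr (posp (1 - `|_|)); rewrite -[l.*2]muln2 natrM; ring.
(* For l = 0 the left neighbour would be cell -1, whose hat vanishes because p >= 0. *)
case: l => [|l].
  by rewrite posp_eq0 ?mulr0// subr0 ger0_norm; lra.
by congr (_ * posp (1 - `|_|)); rewrite -[l.*2.+1%:R]natr1 -[l.*2]muln2 natrM -[l.+1%:R]natr1; ring.
Qed.

Lemma wgt_overflow m (p : RR) : 0 <= p <= 1 -> wgt m m.+1 p = 0.
Proof.
move=> /andP[p0 p1]; apply: posp_eq0; rewrite -natr1.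
have : m%:R * p <= m%:R by rewrite ler_piMr.
by move=> h; rewrite ltr0_norm; lra.
Qed.

(** * SCDL_m of an expectation operator in terms of cell masses *)

Section Masses.
Variable E : (datapt -> RR) -> RR.
Hypothesis Eexp : is_expectation E.

Let bwy side m j : bmeas (fun z => cell_wgt side m j z * (z.2 (+) side)%:R).
Proof. by apply: bmeasM; [exact: bmeas_cell_wgt|exact: bmeas_label]. Qed.

Lemma cell_mass_bounds side m j : 0 <= cell_mass E side m j <= 1.
Proof.
apply/andP; split.
  by apply: (expect_ge0 Eexp) => [|z]; [exact: bmeas_cell_wgt|exact: cell_wgt_ge0].
by apply: (expect_le1 Eexp) => [|z]; [exact: bmeas_cell_wgt|exact: cell_wgt_le1].
Qed.

Lemma cell_pos_bounds side m j : 0 <= cell_pos E side m j <= cell_mass E side m j.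
Proof.
apply/andP; split.
  by apply: (expect_ge0 Eexp) => [|z]; [exact: bwy|rewrite mulr_ge0 ?cell_wgt_ge0].
apply: (expect_mono Eexp) => [||z]; [exact: bwy|exact: bmeas_cell_wgt|].
by rewrite ler_piMr ?cell_wgt_ge0//; case: (_ (+) _).
Qed.

Lemma expect_cell_test side m i j :
  E (cell_test side m i j) =
  cell_pos E side m j - cell_mass E side m j * (i.+1%:R / m%:R).
Proof.
have bw := bmeas_cell_wgt side m j.
rewrite [cell_mass _ _ _ _ * _]mulrC -(expectZ Eexp)//.
rewrite -(expectB Eexp) //; last exact: bmeasZ.
by congr E; apply/funext => z; rewrite /cell_test mulrBr; congr (_ - _); rewrite mulrC.
Qed.

Lemma cell_mass_refl m : cell_mass E true m = refl_seq m (cell_mass E false m).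
Proof. by []. Qed.

Lemma cell_pos_refl m : cell_pos E true m =
  refl_seq m (fun j => cell_mass E false m j - cell_pos E false m j).
Proof.
apply/funext => j; rewrite /refl_seq /cell_pos /cell_mass -(expectB Eexp);
  [|exact: bmeas_cell_wgt|exact: (bwy false)].
congr E; apply/funext => z; rewrite /cell_wgt /= addbT addbF.
by case: z.2; rewrite ?mulr1 ?mulr0 ?subrr ?subr0.
Qed.

Definition side_dev (side : bool) (m i : nat) : RR :=
  lowdev m (cell_mass E side m) (cell_pos E side m) i.

(** Reflection turns every upper sum into a lower sum, so only [lowdev] has to be studied. The index
    i = m drops out: its upper sum is empty, and its lower threshold (m+1)/m exceeds every q_j. *)
Lemma SCDLmE m : (0 < m)%N ->
  SCDLm E m = \big[Num.max/0]_(i < m)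
    (side_dev false m i + side_dev true m (m.-1 - i)).
Proof.
move=> m0; have mR : 0 < m%:R :> RR by rewrite ltr0n.
have term (j : nat) (c : RR) : 0 <= c ->
    cell_mass E false m j * posp (cell_pos E false m j / cell_mass E false m j - c) =
    posp (cell_pos E false m j - cell_mass E false m j * c).
  have /andP[p0 _] := cell_mass_bounds false m j.
  have /andP[a0 ap] := cell_pos_bounds false m j.
  (* In an empty cell the quotient has the default value of division by 0, but [cell_pos] is
     squeezed to 0 as well, so both sides vanish. *)
  move=> c0; rewrite pospM// mulrBr; have [e|e] := eqVneq (cell_mass E false m j) 0.
    by rewrite e !mul0r; congr posp; move: ap; rewrite e; lra.
  by rewrite mulrCA divff// mulr1.
have term' (j : nat) (c : RR) : 0 <= c ->
    cell_mass E false m j * posp (c - cell_pos E false m j / cell_mass E false m j) =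
    posp (cell_mass E false m j * c - cell_pos E false m j).
  have /andP[p0 _] := cell_mass_bounds false m j.
  have /andP[a0 ap] := cell_pos_bounds false m j.
  move=> c0; rewrite pospM// mulrBr; have [e|e] := eqVneq (cell_mass E false m j) 0.
    by rewrite e !mul0r; congr posp; move: ap; rewrite e; lra.
  by rewrite [X in _ - X]mulrCA divff// mulr1.
have cp j : E (fun z => wgt m j z.1 * (z.2)%:R) = cell_pos E false m j.
  by congr E; apply/funext => z; rewrite addbF.
have Si (i : 'I_m.+1) :
    \sum_(j < m.+1 | (j <= i)%N) E (fun z => wgt m j z.1) *
       posp (E (fun z => wgt m j z.1 * (z.2)%:R) / E (fun z => wgt m j z.1)
             - (i.+1)%:R / m%:R)
    + \sum_(j < m.+1 | (i < j)%N) E (fun z => wgt m j z.1) *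
       posp (i%:R / m%:R - E (fun z => wgt m j z.1 * (z.2)%:R) / E (fun z => wgt m j z.1))
    = side_dev false m i + highdev m (cell_mass E false m) (cell_pos E false m) i.
  congr (_ + _).
    rewrite /side_dev /lowdev (@big_nat_widen _ _ _ _ i.+1 m.+1)//= big_mkord.
    by apply: eq_bigr => j ji; rewrite cp term ?divr_ge0.
  rewrite /highdev (@big_nat_widenl _ _ _ i.+1 0%N)//= big_mkord.
  by apply: eq_bigr => j ji; rewrite cp term' ?divr_ge0.
pose G (i : nat) := side_dev false m i + highdev m (cell_mass E false m) (cell_pos E false m) i.
have GE i : (i < m)%N -> G i = side_dev false m i + side_dev true m (m.-1 - i).
  by move=> im; rewrite /G highdev_refl// /side_dev cell_pos_refl.
have Glast : G m = 0.
  rewrite /G /highdev big_geq// addr0 /side_dev /lowdev big1// => j _.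
  have /andP[p0 _] := cell_mass_bounds false m j.
  have /andP[a0 ap] := cell_pos_bounds false m j.
  apply: posp_eq0; rewrite subr_le0; apply: le_trans ap _.
  by rewrite ler_peMr// ler_pdivlMr// mul1r ler_nat.
rewrite /SCDLm (eq_bigr _ (fun i _ => Si i)).
apply/eqP; rewrite eq_le; apply/andP; split.
  apply: bigmax_le => [|i _]; first exact: bigmax_ge_id.
  rewrite -/(G i); have [im|im] := ltnP i m.
    rewrite GE//.
    exact: (le_bigmax _ (fun i : 'I_m => side_dev false m i + side_dev true m (m.-1 - i)) (Ordinal im)).
  rewrite (_ : nat_of_ord i = m) ?Glast; first exact: bigmax_ge_id.
  by have := ltn_ord i; lia.
apply: bigmax_le => [|i _]; first exact: bigmax_ge_id.
rewrite -GE//; exact: (le_bigmax _ (fun i : 'I_m.+1 => G i) (widen_ord (leqnSn m) i)).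
Qed.

Lemma side_dev_ge0 side m i : 0 <= side_dev side m i.
Proof. exact: lowdev_ge0. Qed.

Lemma SCDLm_le m (x : RR) : (0 < m)%N -> 0 <= x ->
  (forall i, (i < m)%N -> side_dev false m i + side_dev true m (m.-1 - i) <= x) ->
  SCDLm E m <= x.
Proof. by move=> m0 x0 h; rewrite SCDLmE//; apply: bigmax_le => // i _; exact: h. Qed.

Lemma SCDLm_ge m i : (i < m)%N ->
  side_dev false m i + side_dev true m (m.-1 - i) <= SCDLm E m.
Proof.
move=> im; rewrite SCDLmE; last by lia.
exact: (le_bigmax _ (fun i : 'I_m => side_dev false m i + side_dev true m (m.-1 - i)) (Ordinal im)).
Qed.

Lemma SCDLm_ge0 m : 0 <= SCDLm E m.
Proof. exact: bigmax_ge_id. Qed.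

Lemma side_dev_le side m i : (i < m)%N -> side_dev side m i <= SCDLm E m.
Proof.
move=> im; case: side.
  have im' : (m.-1 - i < m)%N by lia.
  have := SCDLm_ge im'; rewrite (_ : m.-1 - (m.-1 - i) = i)%N; last by lia.
  by have := side_dev_ge0 false m (m.-1 - i); lra.
by have := SCDLm_ge im; have := side_dev_ge0 true m (m.-1 - i); lra.
Qed.

Lemma side_dev_le_size side m i : (0 < m)%N -> side_dev side m i <= i.+1%:R.
Proof.
move=> m0; apply: (@le_trans _ _ (\sum_(0 <= j < i.+1) (1 : RR))); last first.
  by rewrite big_const_nat iter_addr_0 subn0.
apply: ler_sum_nat => j _.
have /andP[p0 p1] := cell_mass_bounds side m j.
have /andP[a0 ap] := cell_pos_bounds side m j.
apply: posp_le => //.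
have : 0 <= cell_mass E side m j * (i.+1%:R / m%:R) by rewrite mulr_ge0 ?divr_ge0.
lra.
Qed.

(** A crude count of cells, each contributing at most 1. It serves at m = 2, where no coarser scale
    is available. *)
Lemma SCDLm_le_size m : (0 < m)%N -> SCDLm E m <= m.+1%:R.
Proof.
move=> m0; apply: SCDLm_le => // i im.
apply: (le_trans (lerD (side_dev_le_size false i m0) (side_dev_le_size true (m.-1 - i) m0))).
by rewrite -natrD ler_nat; lia.
Qed.

Hypothesis Eunit : unit_supported E.

(** Taking expectations in [wgt_refine] shows that the masses refine; by [dev_refine] each coarse
    threshold is then dominated by the average of two fine ones. *)
Lemma SCDLm_double m : (0 < m)%N -> SCDLm E m <= SCDLm E m.*2.
Proof.
move=> m0; apply: SCDLm_le => // [|i im]; first exact: SCDLm_ge0.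
have bw k l : bmeas (cell_wgt false k l) by exact: bmeas_cell_wgt.
have bwl k l := bwy false k l.
have b0 := bmeas_cst 0.
have rp : refines m (cell_mass E false m) (cell_mass E false m.*2).
  split.
    rewrite -[RHS](expect0 Eexp); apply: Eunit => [//|//|z z1]; exact: wgt_overflow.
  move=> l _; rewrite /cell_mass; case: l => [|l].
    rewrite add0r -(expect_lin Eexp)//; apply: Eunit => [//||z z1].
      by apply: bmeasD => //; exact: bmeasZ.
    by rewrite /cell_wgt wgt_refine// add0r.
  have bz := bmeasZ 2^-1 (bw m.*2 l.*2.+1).
  have bd := bmeasD bz (bw m.*2 l.+1.*2).
  rewrite -(expectZ Eexp)// -(expectD Eexp)// -(expect_lin Eexp)//.
  apply: Eunit => [//||z z1]; first by apply: bmeasD => //; exact: bmeasZ.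
  by rewrite /cell_wgt wgt_refine.
have ra : refines m (cell_pos E false m) (cell_pos E false m.*2).
  split.
    rewrite -[RHS](expect0 Eexp); apply: Eunit => [//|//|z z1].
    by rewrite /cell_wgt wgt_overflow// mul0r.
  move=> l _; rewrite /cell_pos; case: l => [|l].
    rewrite add0r -(expect_lin Eexp)//; apply: Eunit => [//||z z1].
      by apply: bmeasD => //; exact: bmeasZ.
    by rewrite /cell_wgt wgt_refine// add0r mulrDl mulrA.
  have bz := bmeasZ 2^-1 (bwl m.*2 l.*2.+1).
  have bd := bmeasD bz (bwl m.*2 l.+1.*2).
  rewrite -(expectZ Eexp)// -(expectD Eexp)// -(expect_lin Eexp)//.
  apply: Eunit => [//||z z1]; first by apply: bmeasD => //; exact: bmeasZ.
  by rewrite /cell_wgt wgt_refine// !mulrDl !mulrA.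
have pi0 j : 0 <= cell_mass E false m.*2 j by case/andP: (cell_mass_bounds false m.*2 j).
have := dev_refine im pi0 rp ra.
rewrite !highdev_refl; [|lia|lia|lia].
rewrite -!cell_pos_refl -!cell_mass_refl.
have i2 : (i.*2 < m.*2)%N by lia.
have i2' : (i.*2.+1 < m.*2)%N by lia.
have := SCDLm_ge i2; have := SCDLm_ge i2'; rewrite /side_dev; lra.
Qed.

End Masses.

(** * The distribution and the sample as expectation operators *)

Lemma Expect_dist_expectation (D : probability datapt RR) : is_expectation (Expect_dist D).
Proof.
have Dint f : bmeas f -> D.-integrable setT (EFin \o f).
  move=> [mf [B fB]]; apply: measurable_bounded_integrable => //.
    by apply: le_lt_trans (probability_le1 D measurableT) _; exact: ltry.
  by exists B; split; [exact: num_real|move=> M BM z _; exact: le_trans (fB z) (ltW BM)].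
split => [c f g bf bg|f g bf bg fg|].
- rewrite -[RHS]/(\int[D]_x f x + c * \int[D]_x g x)%R.
  rewrite -(RintegralZl _ measurableT (Dint _ bg)).
  rewrite -(RintegralD measurableT (Dint _ bf))//.
  by apply: (Dint (fun z => c * g z)); exact: bmeasZ.
- by apply: (le_Rintegral measurableT (Dint _ bf) (Dint _ bg)) => z _.
- transitivity (1 * fine (D setT)); first exact: (Rintegral_cst D measurableT 1).
  by rewrite probability_setT mul1r.
Qed.

Lemma measurable_unit_pts : measurable [set z : datapt | 0 <= z.1 <= 1].
Proof.
rewrite (_ : [set z | _] = fst @^-1` `[0, 1]%classic); last first.
  by apply/seteqP; split => z /=; rewrite in_itv.
by rewrite -[X in measurable X]setTI; exact: measurable_fst.
Qed.

Lemma Expect_dist_unit (D : probability datapt RR) :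
  D [set z | 0 <= z.1 <= 1] = 1%E -> unit_supported (Expect_dist D).
Proof.
move=> D1 f g bf bg fg.
have Dint h : bmeas h -> D.-integrable setT (EFin \o h).
  move=> [mh [B hB]]; apply: measurable_bounded_integrable => //.
    by apply: le_lt_trans (probability_le1 D measurableT) _; exact: ltry.
  by exists B; split; [exact: num_real|move=> M BM z _; exact: le_trans (hB z) (ltW BM)].
pose N := ~` [set z : datapt | 0 <= z.1 <= 1].
have mN : measurable N by apply: measurableC; exact: measurable_unit_pts.
have N0 : D N = 0%E.
  by rewrite /N probability_setC ?D1 ?subee//; exact: measurable_unit_pts.
rewrite /Expect_dist; congr fine.
rewrite (negligible_integral mN measurableT (Dint _ bf) N0).
rewrite (negligible_integral mN measurableT (Dint _ bg) N0).
apply: eq_integral => z; rewrite inE /N => -[_ /contrapT z1].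
by rewrite /= fg.
Qed.

Lemma Expect_emp_expectation (T : nat) (z : 'I_T -> datapt) : (0 < T)%N ->
  is_expectation (Expect_emp z).
Proof.
move=> T0; have TR : 0 < T%:R :> RR by rewrite ltr0n.
split => [c f g _ _|f g _ _ fg|]; rewrite /Expect_emp.
- by rewrite big_split/= mulrDr -mulr_sumr; congr (_ + _); rewrite mulrCA.
- by rewrite ler_wpM2l ?invr_ge0 ?(ltW TR)//; apply: ler_sum.
- by rewrite sumr_const card_ord mulVf// gt_eqF.
Qed.

Lemma Expect_emp_unit (T : nat) (z : 'I_T -> datapt) :
  (forall j, 0 <= (z j).1 <= 1) -> unit_supported (Expect_emp z).
Proof.
move=> z1 f g _ _ fg; rewrite /Expect_emp; congr (_ * _).
by apply: eq_bigr => j _; rewrite fg.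
Qed.

(* The integral of a nonnegative function is a supremum over simple functions, hence
   monotone even on non-measurable integrands. *)
Lemma ge0_integral_mono d (X : measurableType d) (mu : {measure set X -> \bar RR})
    (f g : X -> \bar RR) :
  (forall x, 0%E <= f x)%E -> (forall x, f x <= g x)%E ->
  (\int[mu]_x f x <= \int[mu]_x g x)%E.
Proof.
move=> f0 fg; have g0 x : (0 <= g x)%E by exact: le_trans (fg x).
rewrite !ge0_integralTE//; apply: ereal_sup_le => _ [h hf <-].
by exists h => // x; exact: le_trans (hf x) (fg x).
Qed.

Lemma integral_scaled_indic d (X : measurableType d) (mu : {measure set X -> \bar RR})
    (c : RR) (U : set X) : measurable U -> 0 <= c ->
  (\int[mu]_x (c * \1_U x)%:E = c%:E * mu U)%E.
Proof.
move=> mU c0; under eq_integral do rewrite EFinM.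
rewrite ge0_integralZl//=; last by apply/measurable_EFinP; exact: measurable_indic.
by rewrite integral_indic// setIT.
Qed.

(** The integrand is dominated by eps + B 1_U. As [ge0_integral_mono] accepts any nonnegative
    integrand, measurability is asked of the exceptional event alone. *)
Lemma integral_le_off_event d (X : measurableType d) (P : probability X RR)
    (F : X -> RR) (U : set X) (eps B delta : RR) :
  measurable U -> (P U <= delta%:E)%E -> 0 <= eps -> 0 <= B ->
  (forall x, 0 <= F x <= B) -> (forall x, ~ U x -> F x <= eps) ->
  (\int[P]_x (F x)%:E <= (eps + B * delta)%:E)%E.
Proof.
move=> mU PU eps0 B0 FB FU.
apply: (@le_trans _ _ (\int[P]_x (eps%:E + (B * \1_U x)%:E))%E).
  apply: ge0_integral_mono => x.
    by rewrite lee_fin; case/andP: (FB x).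
  rewrite -EFinD lee_fin indicE; have [xU|xU] := boolP (x \in U).
    by rewrite mulr1; case/andP: (FB x); lra.
  by rewrite mulr0 addr0; apply: FU => Ux; move/negP: xU; apply; exact: mem_set.
rewrite ge0_integralD//=; last 2 first.
- by move=> x _; rewrite lee_fin mulr_ge0.
- apply/measurable_EFinP; apply: measurable_funM; first exact: measurable_cst.
  exact: measurable_indic.
rewrite (_ : \int[P]_x eps%:E = eps%:E)%E; last first.
  by transitivity (eps%:E * P setT)%E; [exact: integral_cst|rewrite probability_setT mule1].
rewrite EFinD leeD2l//.
by rewrite integral_scaled_indic// EFinM lee_wpmul2l ?lee_fin.
Qed.

(** Union bound. Saying that [Q] holds outside a small measurable set avoids any claim that [Q]
    itself defines a measurable set. *)
Lemma finite_union_event d (X : measurableType d) (P : probability X RR) (I : finType)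
    (Q : I -> X -> Prop) (e : RR) :
  (forall l, exists U, [/\ measurable U, (P U <= e%:E)%E & forall x, ~ U x -> Q l x]) ->
  exists U, [/\ measurable U, (P U <= (#|I|%:R * e)%:E)%E & forall x, ~ U x -> forall l, Q l x].
Proof.
move=> h.
suff [U [mU PU QU]] : exists U, [/\ measurable U, (P U <= ((size (enum I))%:R * e)%:E)%E &
    forall x, ~ U x -> forall l, l \in enum I -> Q l x].
  exists U; split; [exact: mU|by rewrite cardE|].
  by move=> x Ux l; apply: QU => //; rewrite mem_enum.
elim: (enum I) => [|l s [U [mU PU QU]]].
  by exists set0; split; [exact: measurable0|rewrite measure0 mul0r|].
have [V [mV PV QV]] := h l; exists (V `|` U); split.
- exact: measurableU.
- apply: le_trans (measureU2 P mV mU) _.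
  by rewrite /= -natr1 mulrDl mul1r addrC EFinD leeD.
- move=> x /not_orP[Vx Ux] l'; rewrite inE => /orP[/eqP ->|]; first exact: QV.
  exact: QU.
Qed.

(** * Exponential moments and Bernstein's inequality for an i.i.d. sample *)

Section Iid.
Variables (d : measure_display) (Omega : measurableType d) (P : probability Omega RR).
Variables (D : probability datapt RR) (T : nat) (Z : 'I_T -> Omega -> datapt).
Hypothesis mZ : forall j, measurable_fun setT (Z j).
Hypothesis lawZ : forall j (A : set datapt), measurable A -> P (Z j @^-1` A) = D A.
Hypothesis indepZ : mutually_independent P Z.

Let mpre j A : measurable A -> measurable (Z j @^-1` A).
Proof. by move=> mA; rewrite -[X in measurable X]setTI; exact: mZ. Qed.

(** Independence is given for events. Expanding the product over all maps from indices to [K] leaves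
    indicators of intersections, to which it applies. *)
Lemma integral_prod_simple (K : finType) (A : K -> set datapt) (c : K -> RR) :
  (forall k, measurable (A k)) -> (forall k, 0 <= c k) ->
  (\int[P]_w (\prod_(t < T) \sum_k c k * \1_(A k) (Z t w))%:E =
   ((\sum_k c k * fine (D (A k))) ^+ T)%:E)%E.
Proof.
move=> mA c0.
pose C (phi : {ffun 'I_T -> K}) := \bigcap_(t in [set: 'I_T]) (Z t @^-1` A (phi t)).
have mC phi : measurable (C phi).
  by apply: fin_bigcap_measurable => [|t _]; [exact: finite_finset|exact: mpre].
have PC phi : P (C phi) = (\prod_(t < T) fine (D (A (phi t))))%:E.
  rewrite (indepZ (A := fun t => A (phi t)))// -prodEFin; apply: eq_bigr => t _.
  by rewrite lawZ// fineK// fin_num_measure.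
have CE (phi : {ffun 'I_T -> K}) w : \prod_(t < T) (c (phi t) * \1_(A (phi t)) (Z t w)) =
    (\prod_(t < T) c (phi t)) * \1_(C phi) w.
  rewrite big_split /=; congr (_ * _); rewrite indicE.
  have [/set_mem wC|wC] := boolP (w \in C phi).
    by rewrite big1// => t _; rewrite indicE mem_set//; exact: wC.
  have /existsNP[t /not_implyP[_ wt]] : ~ C phi w by move/mem_set; apply/negP.
  by rewrite (bigD1 t)//= indicE memNset// mul0r.
rewrite (_ : (fun w => _) = (fun w => \sum_(phi : {ffun 'I_T -> K})
    ((\prod_(t < T) c (phi t)) * \1_(C phi) w)%:E)%E); last first.
  apply/funext => w; rewrite bigA_distr_bigA -sumEFin; apply: eq_bigr => phi _.
  by rewrite CE.
have pc0 (phi : {ffun 'I_T -> K}) : 0 <= \prod_(t < T) c (phi t) by apply: prodr_ge0.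
rewrite ge0_integral_sum//; last 2 first.
- move=> phi; apply/measurable_EFinP; apply: measurable_funM; first exact: measurable_cst.
  exact: measurable_indic.
- by move=> phi w _; rewrite lee_fin mulr_ge0.
rewrite -[in RHS](card_ord T) -prodr_const bigA_distr_bigA -sumEFin.
apply: eq_bigr => phi _.
by rewrite integral_scaled_indic// [X in (_ * X)%E](PC phi) -EFinM big_split.
Qed.

(* Rounding f up to multiples of 1/T turns the product into a combination of
   indicators, at the price of a factor (1 + 1/T)^T <= e. *)
Lemma prod_markov (f : datapt -> RR) (a : RR) : (0 < T)%N -> 0 < a ->
  bmeas f -> (forall z, 0 <= f z) -> Expect_dist D f <= 1 ->
  measurable [set w | a <= \prod_(t < T) f (Z t w)] /\
  (P [set w | (a <= \prod_(t < T) f (Z t w))%R] <= (expR 1 / a)%:E)%E.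
Proof.
move=> T0 a0 bf f0 Ef; have [mf [B fB]] := bf.
have TR : 0 < T%:R :> RR by rewrite ltr0n.
set G := [set w | _].
have mG : measurable G.
  have mp : measurable_fun setT (fun w => \prod_(t < T) f (Z t w)).
    by apply: measurable_prod => t _; apply: measurableT_comp.
  have -> : G = (fun w => \prod_(t < T) f (Z t w)) @^-1` `[a, +oo[%classic.
    by apply/seteqP; split => w /=; rewrite in_itv/= andbT.
  by rewrite -[X in measurable X]setTI; exact: mp.
split => //.
(* Levels of width 1/T up to the bound B: [c k] is the upper end of level k, and [lev z] is the
   level that contains f z. *)
pose n := (Num.truncn (T%:R * B)).+1.
pose A (k : 'I_n) := [set z : datapt | k%:R <= T%:R * f z < k.+1%:R].
pose c (k : 'I_n) : RR := k.+1%:R / T%:R.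
have c0 k : 0 <= c k by rewrite divr_ge0// ltW.
have mA k : measurable (A k).
  have -> : A k = (fun z => T%:R * f z) @^-1` `[k%:R, k.+1%:R[%classic.
    by apply/seteqP; split => z /=; rewrite in_itv.
  rewrite -[X in measurable X]setTI; apply: measurable_funM => //; exact: measurable_cst.
pose lev z : 'I_n := inord (Num.truncn (T%:R * f z)).
have Tf0 z : 0 <= T%:R * f z by rewrite mulr_ge0// ltW.
have levE z : lev z = Num.truncn (T%:R * f z) :> nat.
  rewrite inordK// /n ltnS; apply: le_truncn.
  by rewrite ler_wpM2l ?(ltW TR)//; apply: le_trans (fB z); exact: ler_norm.
have sumE z : \sum_k c k * \1_(A k) z = c (lev z).
  rewrite (bigD1 (lev z))//= big1 ?addr0.
    rewrite indicE mem_set ?mulr1// /A /= levE.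
    exact: truncn_itv.
  move=> k kl; rewrite indicE memNset ?mulr0// => Akz.
  move/negP: kl; apply; apply/eqP/val_inj => /=; rewrite levE.
  apply/esym; apply: truncn_def; exact: Akz.
have f_le z : f z <= c (lev z).
  rewrite /c levE ler_pdivlMr// mulrC; apply/ltW.
  by case/andP: (truncn_itv (Tf0 z)).
have c_le z : c (lev z) <= f z + T%:R^-1.
  rewrite /c levE ler_pdivrMr// mulrDl mulVf ?gt_eqF// -natr1 lerD2r [f z * _]mulrC.
  by case/andP: (truncn_itv (Tf0 z)).
have sumD : \sum_k c k * fine (D (A k)) <= 1 + T%:R^-1.
  have ED := Expect_dist_expectation D.
  have bA k : bmeas (fun z => \1_(A k) z : RR).
    split; first exact: measurable_indic.
    by exists 1 => z; rewrite indicE; case: (_ \in _); rewrite ?normr0 ?normr1.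
  have -> : \sum_k c k * fine (D (A k)) = Expect_dist D (fun z => \sum_k c k * \1_(A k) z).
    (* [expect_sum] runs over natural numbers, so the ordinal-indexed family is extended by 0. *)
    pose g (j : nat) z : RR := if insub j is Some k then c k * \1_(A k) z else 0.
    have bg j : bmeas (g j).
      by rewrite /g; case: insub => [k|]; [exact: bmeasZ|exact: bmeas_cst].
    have gE (k : 'I_n) : g k = fun z => c k * \1_(A k) z.
      by rewrite /g valK.
    transitivity (\sum_(0 <= j < n) Expect_dist D (g j)).
      rewrite big_mkord; apply: eq_bigr => k _; rewrite gE (expectZ ED)//.
      by rewrite /Expect_dist integral_indic// setIT.
    rewrite -(expect_sum ED)//; congr (Expect_dist D); apply/funext => z.
    by rewrite big_mkord; apply: eq_bigr => k _; rewrite gE.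
  have -> : (fun z => \sum_k c k * \1_(A k) z) = (fun z => c (lev z)).
    by apply/funext => z; exact: sumE.
  have bc : bmeas (fun z => c (lev z)).
    split.
      rewrite (_ : (fun z => _) = (fun z => \sum_(k < n) c k * \1_(A k) z)); last first.
        by apply/funext => z; rewrite sumE.
      apply: measurable_sum => k; apply: measurable_funM; first exact: measurable_cst.
      exact: measurable_indic.
    exists (B + T%:R^-1) => z; rewrite ger0_norm//; apply: le_trans (c_le z) _.
    by rewrite lerD2r; apply: le_trans (fB z); exact: ler_norm.
  apply: (@le_trans _ _ (Expect_dist D (fun z => f z + T%:R^-1))).
    apply: (expect_mono ED) => //.
    by apply: bmeasD => //; exact: bmeas_cst.
  rewrite (expectD ED)//; last exact: bmeas_cst.
  rewrite lerD// (_ : (fun=> _) = (fun _ : datapt => T%:R^-1 * 1)); last first.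
    by apply/funext => z; rewrite mulr1.
  by rewrite (expectZ ED) ?(expect1 ED) ?mulr1//; exact: bmeas_cst.
have sumD0 : 0 <= \sum_k c k * fine (D (A k)).
  by apply: sumr_ge0 => k _; rewrite mulr_ge0// fine_ge0.
have T1_ge0 : 0 <= 1 + T%:R^-1 :> RR by rewrite addr_ge0// invr_ge0 ltW.
have powle : (\sum_k c k * fine (D (A k))) ^+ T <= expR 1.
  apply: (@le_trans _ _ ((1 + T%:R^-1) ^+ T)).
    by apply: lerXn2r; rewrite ?nnegrE.
  apply: (@le_trans _ _ (expR T%:R^-1 ^+ T)).
    by apply: lerXn2r; rewrite ?nnegrE ?expR_ge0 ?expR_ge1Dx.
  by rewrite -expRM_natl mulfV// gt_eqF.
have : (\int[P]_w (a * \1_G w)%:E <= (expR 1)%:E)%E.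
  apply: (@le_trans _ _ (\int[P]_w (\prod_(t < T) \sum_k c k * \1_(A k) (Z t w))%:E)%E).
    apply: ge0_integral_mono => w.
      by rewrite lee_fin mulr_ge0// ltW.
    have pr0 : 0 <= \prod_(t < T) \sum_k c k * \1_(A k) (Z t w).
      by apply: prodr_ge0 => t _; rewrite sumE.
    rewrite lee_fin indicE; have [/set_mem wG|_] := boolP (w \in G); last by rewrite mulr0.
    rewrite mulr1; apply: le_trans wG _; apply: ler_prod => t _.
    by rewrite f0 sumE f_le.
  by rewrite integral_prod_simple// lee_fin.
rewrite integral_scaled_indic ?(ltW a0)// => h.
have PGf : P G \is a fin_num by exact: fin_num_measure.
rewrite -(fineK PGf) lee_fin ler_pdivlMr// mulrC.
by rewrite -lee_fin EFinM fineK.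
Qed.

(** From e^-u >= 1 - u one gets e^u <= 1/(1-u), and (1-u)(1+u+2u^2) = 1 + u^2(1-2u). *)
Lemma expR_le_quad (u : RR) : u <= 2^-1 -> expR u <= 1 + u + 2 * u ^+ 2.
Proof.
move=> u2; have p : 0 < 1 - u by lra.
have h : expR u <= (1 - u)^-1.
  rewrite -[u]opprK exp.expRN lef_pV2 ?posrE ?expR_gt0 ?opprK//.
  exact: expR_ge1Dx.
apply: le_trans h _; rewrite -[leLHS]mul1r ler_pdivrMr//.
have : 0 <= u ^+ 2 * (1 - 2 * u) by rewrite mulr_ge0 ?sqr_ge0//; lra.
nra.
Qed.

(** Chernoff's method: the shift [s] makes exp(lam g - s) have expectation at most 1, and
    [prod_markov] is applied at level e^x. Its factor e gives the 1 in the exponent 1 - x. *)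
Lemma bernstein_event (g : datapt -> RR) (lam V x : RR) : (0 < T)%N ->
  bmeas g -> (forall z, `|g z| <= 1) -> 0 < lam <= 2^-1 ->
  Expect_dist D (fun z => g z ^+ 2) <= V ->
  exists U, [/\ measurable U, (P U <= (expR (1 - x))%:E)%E & forall w, ~ U w ->
    Expect_emp (fun j => Z j w) g - Expect_dist D g <= 2 * lam * V + x / T%:R / lam].
Proof.
move=> T0 bg g1 /andP[lam0 lam2] EV.
have TR : 0 < T%:R :> RR by rewrite ltr0n.
have ED := Expect_dist_expectation D.
set mu := Expect_dist D g.
set s := lam * mu + 2 * lam ^+ 2 * V.
pose f z := expR (lam * g z - s).
have lg z : lam * g z <= 2^-1.
  apply: le_trans lam2; rewrite ler_piMr ?(ltW lam0)//.
  exact: le_trans (ler_norm _) (g1 z).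
have bf : bmeas f.
  split.
    apply: measurableT_comp; first exact: measurable_expR.
    by have [] := bmeasB (bmeasZ lam bg) (bmeas_cst s).
  exists (expR (2^-1 - s)) => z; rewrite ger0_norm ?expR_ge0// ler_expR.
  by rewrite lerD2r.
have bg2 : bmeas (fun z => g z ^+ 2).
  by have := bmeasM bg bg; congr bmeas; apply/funext => z; rewrite expr2.
have Ef : Expect_dist D f <= 1.
  pose q z := expR (- s) * (1 + (lam * g z + (2 * lam ^+ 2) * g z ^+ 2)).
  have bq1 := bmeasD (bmeasZ lam bg) (bmeasZ (2 * lam ^+ 2) bg2).
  have bq2 := bmeasD (bmeas_cst 1) bq1.
  apply: (@le_trans _ _ (Expect_dist D q)).
    apply: (expect_mono ED) => // [|z]; first exact: bmeasZ.
    rewrite /f /q addrC exp.expRD ler_wpM2l ?expR_ge0//.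
    by apply: le_trans (expR_le_quad (lg z)) _; rewrite exprMn; lra.
  rewrite (expectZ ED)// (expectD ED) ?(expect1 ED)//; last exact: bmeas_cst.
  rewrite (expectD ED); [|exact: bmeasZ|exact: bmeasZ].
  rewrite !(expectZ ED)// -/mu.
  apply: (@le_trans _ _ (expR (- s) * (1 + s))).
    rewrite ler_wpM2l ?expR_ge0// lerD2l /s lerD2l ler_wpM2l//.
    by rewrite mulr_ge0 ?sqr_ge0.
  apply: (@le_trans _ _ (expR (- s) * expR s)).
    by rewrite ler_wpM2l ?expR_ge0 ?expR_ge1Dx.
  by rewrite -exp.expRD addNr exp.expR0.
have f0 z : 0 <= f z by exact: expR_ge0.
have [mU PU] := prod_markov T0 (expR_gt0 x) bf f0 Ef.
eexists; split; [exact: mU|by rewrite exp.expRD exp.expRN; exact: PU|].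
move=> w /= /negP; rewrite -ltNge.
have -> : \prod_(t < T) f (Z t w) =
    expR (lam * (T%:R * Expect_emp (fun j => Z j w) g) - T%:R * s).
  rewrite -expR_sum; congr expR; rewrite sumrB -mulr_sumr sumr_const card_ord.
  by rewrite -[s *+ T]mulr_natl /Expect_emp [T%:R * (_ * _)]mulrA mulfV ?mul1r// gt_eqF.
rewrite ltr_expR => h.
have lT : 0 < lam * T%:R by rewrite mulr_gt0.
rewrite -(ler_pM2l lT) [leRHS]mulrDr.
have -> : lam * T%:R * (x / T%:R / lam) = x by field; rewrite !gt_eqF.
by move: h; rewrite /s; set e := Expect_emp _ _; lra.
Qed.

End Iid.

(** * Dyadic scales and stability of SCDL *)

Definition dyadic_SCDL (E : (datapt -> RR) -> RR) (k : nat) : RR := SCDLm E (2 ^ k.+1)%N.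

Definition dyadic_width (k : nat) : RR := ((2 ^ k.+1)%N%:R)^-1.

Lemma dyadic_width_gt0 k : 0 < dyadic_width k.
Proof. by rewrite invr_gt0 ltr0n expn_gt0. Qed.

Lemma dyadic_widthS k : dyadic_width k = 2 * dyadic_width k.+1.
Proof.
rewrite /dyadic_width [in RHS]expnS natrM invfM mulrA divff ?mul1r//.
Qed.

Lemma dyadic_width_anti k l : (k <= l)%N -> dyadic_width l <= dyadic_width k.
Proof.
move=> kl; rewrite /dyadic_width lef_pV2 ?posrE ?ltr0n ?expn_gt0// ler_nat.
by rewrite leq_exp2l.
Qed.

Section Dyadic.
Variable E : (datapt -> RR) -> RR.
Hypothesis Eexp : is_expectation E.

Lemma SCDL_le k : SCDL E <= Num.max (dyadic_SCDL E k) (dyadic_width k).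
Proof.
apply: ge_inf; last by exists k.
exists 0 => _ [l ->]; rewrite le_max; apply/orP; right.
exact: ltW (dyadic_width_gt0 l).
Qed.

Lemma SCDL_ge x : (forall k, x <= Num.max (dyadic_SCDL E k) (dyadic_width k)) -> x <= SCDL E.
Proof.
move=> h; apply: lb_le_inf; last by move=> _ [k ->]; exact: h.
by exists (Num.max (dyadic_SCDL E 0) (dyadic_width 0)); exists 0%N.
Qed.

Lemma SCDL_bounds : 0 <= SCDL E <= 3.
Proof.
apply/andP; split.
  by apply: SCDL_ge => k; rewrite le_max (ltW (dyadic_width_gt0 k)) orbT.
apply: le_trans (SCDL_le 0) _; rewrite ge_max /dyadic_SCDL /dyadic_width expn1.
by rewrite (SCDLm_le_size Eexp)//=; lra.
Qed.

Hypothesis Eunit : unit_supported E.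

Lemma dyadic_SCDL_mono k l : (k <= l)%N -> dyadic_SCDL E k <= dyadic_SCDL E l.
Proof.
move=> /subnKC <-; elim: (l - k)%N => [|n IH]; first by rewrite addn0.
apply: le_trans IH _; rewrite addnS /dyadic_SCDL [X in SCDLm _ X <= _]/=.
rewrite [X in _ <= SCDLm _ X]expnS mul2n; apply: SCDLm_double => //.
by rewrite expn_gt0.
Qed.

Lemma SCDL_ge_dyadic0 : dyadic_SCDL E 0 <= SCDL E.
Proof. by apply: SCDL_ge => k; rewrite le_max dyadic_SCDL_mono. Qed.

(** Scales up to k are at least as wide as scale k; on finer ones monotonicity gives at least the
    value at k + 1. *)
Lemma SCDL_ge_min k : Num.min (dyadic_SCDL E k.+1) (dyadic_width k) <= SCDL E.
Proof.
apply: SCDL_ge => l; have [lk|kl] := leqP l k.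
  by rewrite ge_min !le_max (dyadic_width_anti lk) !orbT.
by rewrite ge_min !le_max (dyadic_SCDL_mono kl).
Qed.

Lemma SCDL_eq0 k : SCDL E = 0 -> dyadic_SCDL E k = 0.
Proof.
move=> v0; have := SCDL_ge_min k; rewrite v0 ge_min => /orP[s0|w0].
  apply/eqP; rewrite eq_le SCDLm_ge0 andbT; apply: le_trans s0.
  exact: dyadic_SCDL_mono.
by have := dyadic_width_gt0 k; lra.
Qed.

End Dyadic.

(* SCDL_m grows with m while 1/m decreases, so SCDL is determined by the scale where
   the two cross; only that scale has to be estimated well. *)
Lemma SCDL_compare (E : (datapt -> RR) -> RR) (K0 : nat) :
  is_expectation E -> unit_supported E ->
  exists ku kl, [/\ (ku <= K0)%N, (kl <= K0)%N, dyadic_SCDL E ku <= 6 * dyadic_width ku &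
    forall E' eps, is_expectation E' -> unit_supported E' -> 0 <= eps ->
      dyadic_SCDL E' ku <= dyadic_SCDL E ku + eps ->
      dyadic_SCDL E kl - eps <= dyadic_SCDL E' kl ->
      `|SCDL E' - SCDL E| <= 2 * dyadic_width K0 + eps].
Proof.
move=> Eexp Eunit.
(* If no crossing occurs up to the cutoff, both values lie between 0 and [dyadic_width K0] + eps. *)
have [sK|sK] := leP (dyadic_SCDL E K0) (dyadic_width K0).
  have hK := dyadic_width_gt0 K0.
  exists K0, K0; split => //; first by lra.
  move=> E' eps E'exp E'unit eps0 up _.
  have := SCDL_le E K0; rewrite max_r// => h1.
  have /andP[v0 _] := SCDL_bounds Eexp; have /andP[v0' _] := SCDL_bounds E'exp.
  have h2 : SCDL E' <= dyadic_width K0 + eps.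
    by apply: le_trans (SCDL_le E' K0) _; rewrite ge_max; apply/andP; split; lra.
  by rewrite ler_norml; apply/andP; split; lra.
have hK := dyadic_width_gt0 K0.
have ex : exists k, dyadic_width k < dyadic_SCDL E k by exists K0.
(* k is the first scale at which SCDL_m exceeds 1/m. *)
case: (ex_minnP ex) => k sk kmin; have kK := kmin _ sK.
have hk := dyadic_width_gt0 k.
have vle : SCDL E <= dyadic_SCDL E k by have := SCDL_le E k; rewrite max_l// ltW.
case: k sk kmin kK hk vle => [|k] sk kmin kK hk vle.
  (* Crossing already at m = 2: SCDL(D) equals SCDL_2(D), and SCDL_2 <= 3 = 6 * (1/2) is the source
     of the constant 6. *)
  exists 0%N, 0%N; split => //.
    have := @SCDLm_le_size E Eexp 2 isT.
    by rewrite /dyadic_SCDL /dyadic_width expn1; lra.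
  move=> E' eps E'exp E'unit eps0 up low.
  have := SCDL_ge_dyadic0 Eexp Eunit; have := SCDL_ge_dyadic0 E'exp E'unit => h1 h2.
  have h3 : SCDL E' <= dyadic_SCDL E 0 + eps.
    by apply: le_trans (SCDL_le E' 0) _; rewrite ge_max; apply/andP; split; lra.
  by rewrite ler_norml; apply/andP; split; lra.
have sk' : dyadic_SCDL E k <= dyadic_width k.
  by rewrite leNgt; apply/negP => /kmin; rewrite ltnn.
have vle' : SCDL E <= dyadic_width k by have := SCDL_le E k; rewrite max_r.
have low_bound E' eps : is_expectation E' -> unit_supported E' -> 0 <= eps ->
    dyadic_SCDL E k.+1 - eps <= dyadic_SCDL E' k.+1 -> SCDL E - eps <= SCDL E'.
  move=> E'exp E'unit eps0 low; apply: le_trans (SCDL_ge_min E'exp E'unit k).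
  by rewrite le_min; apply/andP; split; lra.
have dS := dyadic_widthS k.
have := SCDL_ge_min Eexp Eunit k.
(* If SCDL_m at k + 1 is at most the width at k, scale k + 1 serves for both directions. Otherwise
   SCDL(D) equals the width at k, and the upper estimate moves to scale k. *)
have [small|big] := leP (dyadic_SCDL E k.+1) (dyadic_width k) => vge.
  exists k.+1, k.+1; split => //; first by lra.
  move=> E' eps E'exp E'unit eps0 up low; have h1 := low_bound _ _ E'exp E'unit eps0 low.
  have h2 : SCDL E' <= dyadic_SCDL E k.+1 + eps.
    by apply: le_trans (SCDL_le E' k.+1) _; rewrite ge_max; apply/andP; split; lra.
  by rewrite ler_norml; apply/andP; split; lra.
have hk' := dyadic_width_gt0 k.
exists k, k.+1; split => //; [exact: ltnW|by lra|].
move=> E' eps E'exp E'unit eps0 up low; have h1 := low_bound _ _ E'exp E'unit eps0 low.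
have h2 : SCDL E' <= dyadic_width k + eps.
  by apply: le_trans (SCDL_le E' k) _; rewrite ge_max; apply/andP; split; lra.
by rewrite ler_norml; apply/andP; split; lra.
Qed.

(** * High-probability events for the sample *)

Lemma and_event d (X : measurableType d) (P : probability X RR) (Q1 Q2 : X -> Prop)
    (e1 e2 : RR) :
  (exists U, [/\ measurable U, (P U <= e1%:E)%E & forall x, ~ U x -> Q1 x]) ->
  (exists U, [/\ measurable U, (P U <= e2%:E)%E & forall x, ~ U x -> Q2 x]) ->
  exists U, [/\ measurable U, (P U <= (e1 + e2)%:E)%E & forall x, ~ U x -> Q1 x /\ Q2 x].
Proof.
move=> [U [mU PU QU]] [V [mV PV QV]]; exists (U `|` V); split.
- exact: measurableU.
- by apply: le_trans (measureU2 P mU mV) _; rewrite EFinD leeD.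
- by move=> x /not_orP[Ux Vx]; split; [exact: QU|exact: QV].
Qed.

Section SampleEvents.
Variables (d : measure_display) (Omega : measurableType d) (P : probability Omega RR).
Variables (D : probability datapt RR) (T : nat) (Z : 'I_T -> Omega -> datapt).
Hypothesis T0 : (0 < T)%N.
Hypothesis mZ : forall j, measurable_fun setT (Z j).
Hypothesis lawZ : forall j (A : set datapt), measurable A -> P (Z j @^-1` A) = D A.
Hypothesis indepZ : mutually_independent P Z.

Let ED := Expect_dist D.
Let ES w := Expect_emp (fun j => Z j w).
Let EDexp : is_expectation ED := Expect_dist_expectation D.
Let ESexp w : is_expectation (ES w) := Expect_emp_expectation (fun j => Z j w) T0.

Lemma unit_event : D [set z | 0 <= z.1 <= 1] = 1%E ->
  exists U, [/\ measurable U, (P U <= 0%:E)%E & forall w, ~ U w -> unit_supported (ES w)].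
Proof.
move=> D1.
have [U [mU PU QU]] : exists U, [/\ measurable U, (P U <= (#|'I_T|%:R * 0)%:E)%E &
    forall w, ~ U w -> forall j, 0 <= (Z j w).1 <= 1].
  apply: finite_union_event => j.
  have mN := measurableC measurable_unit_pts.
  exists (Z j @^-1` (~` [set z | 0 <= z.1 <= 1])); split.
  - by rewrite -[X in measurable X]setTI; exact: mZ.
  - by rewrite lawZ// probability_setC ?D1 ?subee//; exact: measurable_unit_pts.
  - by move=> w /= /contrapT.
exists U; split => [//||w Uw]; first by rewrite mulr0 in PU.
exact: Expect_emp_unit (QU w Uw).
Qed.

(** The parameter [lam] of [lowdev_perturb], computed from the masses of D and hence not random, as
    Bernstein's inequality requires. *)
Definition cell_rate (th : RR) (side : bool) (m i j : nat) : RR :=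
  if j == i then th else
  if near_cell m (cell_mass ED side m) (cell_pos ED side m) i j then th * (i - j)%:R
  else (i - j)%:R / (8 * m%:R).

(** Bernstein with variance bound pi_j for each of the 2 m^2 triples (side, i, j). The condition on
    th m keeps every near rate at most 1/2; far rates are at most 1/8. *)
Lemma upper_event (m : nat) (th x : RR) : (0 < m)%N -> 0 < th -> th * m%:R <= 2^-1 ->
  exists U, [/\ measurable U, (P U <= (2 * m%:R ^+ 2 * expR (1 - x))%:E)%E &
   forall w, ~ U w -> forall side i j, (j <= i < m)%N ->
    (cell_pos (ES w) side m j - cell_mass (ES w) side m j * (i.+1%:R / m%:R))
    - (cell_pos ED side m j - cell_mass ED side m j * (i.+1%:R / m%:R))
    <= 2 * cell_rate th side m i j * cell_mass ED side m j
       + x / T%:R / cell_rate th side m i j].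
Proof.
move=> m0 th0 thm; have mR : 0 < m%:R :> RR by rewrite ltr0n.
have th2 : th <= 2^-1.
  by apply: le_trans thm; rewrite ler_peMr ?(ltW th0)// ler1n.
pose I := (bool * 'I_m * 'I_m)%type.
pose Q (l : I) w := (l.2 <= l.1.2)%N ->
    ES w (cell_test l.1.1 m l.1.2 l.2) - ED (cell_test l.1.1 m l.1.2 l.2)
    <= 2 * cell_rate th l.1.1 m l.1.2 l.2 * cell_mass ED l.1.1 m l.2
       + x / T%:R / cell_rate th l.1.1 m l.1.2 l.2.
have [U [mU PU QU]] : exists U, [/\ measurable U,
    (P U <= (#|{: I}|%:R * expR (1 - x))%:E)%E & forall w, ~ U w -> forall l, Q l w].
  apply: finite_union_event => -[[side i] j]; rewrite /Q /=.
  have [ji|ij] := leqP j i; last first.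
    by exists set0; split => //; rewrite measure0 lee_fin expR_ge0.
  have [||||U [mU PU QU]] := bernstein_event mZ lawZ indepZ (g := cell_test side m i j)
      (lam := cell_rate th side m i j) (V := cell_mass ED side m j) x T0.
  - exact: bmeas_cell_test.
  - by move=> z; apply: le_trans (cell_test_norm side j z (ltn_ord i)) (cell_wgt_le1 _ _ _ _).
  - have ijm : (i - j)%:R <= m%:R :> RR by rewrite ler_nat; have := ltn_ord i; lia.
    rewrite /cell_rate; case: eqP => [_|/eqP ne]; first by rewrite th0.
    have ij0 : 0 < (i - j)%:R :> RR by rewrite ltr0n subn_gt0 ltn_neqAle ne.
    case: ifP => _.
      rewrite mulr_gt0//=; apply: le_trans thm.
      by rewrite ler_wpM2l// ltW.
    rewrite divr_gt0 ?mulr_gt0//= ler_pdivrMr ?mulr_gt0//; lra.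
  - apply: (expect_mono EDexp); [|exact: bmeas_cell_wgt|].
      have := bmeasM (bmeas_cell_test side m i j) (bmeas_cell_test side m i j).
      by congr bmeas; apply/funext => z; rewrite expr2.
    by move=> z; exact: cell_test_sqr.
  by exists U; split => // w Uw _; exact: QU.
exists U; split => //.
  apply: le_trans PU _; rewrite lee_fin /I !card_prod card_bool !card_ord.
  by rewrite !natrM expr2 mulrA.
move=> w Uw side i j /andP[ji im].
have jm : (j < m)%N by exact: leq_ltn_trans im.
have := QU w Uw (side, Ordinal im, Ordinal jm) ji.
by rewrite /= (expect_cell_test (ESexp w)) (expect_cell_test EDexp).
Qed.

(** For this direction one test per side and threshold suffices. Selecting the cells whose signed
    mass under D is positive gives [phi], bounded by 1, whose expectation is [side_dev] under D and
    at most [side_dev] under the sample. *)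
Lemma lower_event (m : nat) (th x : RR) : (0 < m)%N -> 0 < th <= 2^-1 ->
  exists U, [/\ measurable U, (P U <= (2 * m%:R * expR (1 - x))%:E)%E &
   forall w, ~ U w -> SCDLm ED m <= SCDLm (ES w) m + 2 * (2 * th + x / T%:R / th)].
Proof.
move=> m0 th02.
pose I := (bool * 'I_m)%type.
pose eps := 2 * th + x / T%:R / th.
pose Q (l : I) w := side_dev ED l.1 m l.2 <= side_dev (ES w) l.1 m l.2 + eps.
have [U [mU PU QU]] : exists U, [/\ measurable U,
    (P U <= (#|{: I}|%:R * expR (1 - x))%:E)%E & forall w, ~ U w -> forall l, Q l w].
  apply: finite_union_event => -[side i]; rewrite /Q /=.
  pose t j : datapt -> RR := cell_test side m i j.
  pose c j : RR := if 0 < ED (t j) then 1 else 0.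
  have bt j : bmeas (t j) by exact: bmeas_cell_test.
  pose phi z := \sum_(0 <= j < i.+1) c j * t j z.
  have bct j : bmeas (fun z => c j * t j z) by exact: bmeasZ.
  have bphi : bmeas phi by exact: bmeas_sum.
  have phiE E : is_expectation E -> E phi = \sum_(0 <= j < i.+1) c j * E (t j).
    move=> Ee; rewrite (expect_sum Ee)//; apply: eq_bigr => j _.
    by rewrite (expectZ Ee).
  have phi1 z : `|-1 * phi z| <= 1.
    rewrite mulN1r normrN.
    apply: le_trans (@sum_cell_wgt_le1 side m i.+1 z _); last by have := ltn_ord i; lia.
    apply: le_trans (ler_norm_sum _ _ _) _; apply: ler_sum_nat => j _.
    apply: le_trans (cell_test_norm side j z (ltn_ord i)).
    by rewrite normrM /c; case: ifP => _; rewrite ?normr1 ?normr0 ?mul1r ?mul0r.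
  have bN := bmeasZ (-1) bphi.
  have [||||U [mU PU QU]] := bernstein_event mZ lawZ indepZ (g := fun z => -1 * phi z)
      (lam := th) (V := 1) x T0.
  - exact: bN.
  - exact: phi1.
  - exact: th02.
  - apply: (expect_le1 EDexp) => [|z].
      by have := bmeasM bN bN; congr bmeas; apply/funext => z; rewrite expr2.
    rewrite -real_normK ?num_real// expr_le1//.
  exists U; split => // w Uw; have := QU w Uw.
  rewrite -/(ES w) -/ED (expectZ (ESexp w) _ bphi) (expectZ EDexp _ bphi) mulr1 => dev.
  have h1 : side_dev ED side m i = ED phi.
    rewrite (phiE _ EDexp) /side_dev /lowdev; apply: eq_bigr => j _.
    rewrite -(expect_cell_test EDexp) /c -/(t j).
    by have [p|p] := ltP 0 (ED (t j)); rewrite /posp ?mul1r ?mul0r; [rewrite max_l ?ltW|rewrite max_r].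
  have h2 : ES w phi <= side_dev (ES w) side m i.
    rewrite (phiE _ (ESexp w)) /side_dev /lowdev; apply: ler_sum_nat => j _.
    rewrite -(expect_cell_test (ESexp w)) /c -/(t j).
    by case: ifP => _; rewrite ?mul1r ?mul0r ?posp_ge ?posp_ge0.
  by rewrite /eps h1; lra.
exists U; split => //.
  by apply: le_trans PU _; rewrite lee_fin /I card_prod card_bool card_ord natrM.
(* The sign of x is free, so nonnegativity of the bound is read off from threshold 0. *)
have e0 w : ~ U w -> 0 <= SCDLm (ES w) m + 2 * eps.
  move=> Uw; have := QU w Uw (false, Ordinal m0); have := QU w Uw (true, Ordinal (ltac:(lia) : (m.-1 < m)%N)).
  rewrite /Q /=.
  have := side_dev_ge0 ED false m 0; have := side_dev_ge0 ED true m m.-1.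
  have := SCDLm_ge (ESexp w) m0; rewrite subn0; lra.
move=> w Uw; apply: (SCDLm_le EDexp m0) => [|i im]; first exact: e0.
have im' : (m.-1 - i < m)%N by lia.
have := QU w Uw (false, Ordinal im); have := QU w Uw (true, Ordinal im').
have := SCDLm_ge (ESexp w) im; rewrite /Q /= -/eps; lra.
Qed.

(** The bound 6/m is what [SCDL_compare] guarantees at its upper scale; with s = 6/m the near mass
    4msK becomes 24K. The outer factor 2 counts the two sides. *)
Lemma SCDLm_upper_smooth (K : nat) (th x : RR) (m := (2 ^ K)%N) :
  0 < th -> th * m%:R <= 2^-1 -> 0 <= x -> SCDLm ED m <= 6 / m%:R ->
  exists U, [/\ measurable U, (P U <= (2 * m%:R ^+ 2 * expR (1 - x))%:E)%E &
   forall w, ~ U w -> SCDLm (ES w) m <= SCDLm ED m +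
     2 * (2 * th * (1 + 24 * K%:R) + x / T%:R / th * (1 + K%:R)
          + 8 * m%:R * (x / T%:R) * K%:R)].
Proof.
move=> th0 thm x0 s6.
have m0 : (0 < m)%N by rewrite expn_gt0.
have mR : 0 < m%:R :> RR by rewrite ltr0n.
have y0 : 0 <= x / T%:R by rewrite divr_ge0.
have [U [mU PU QU]] := upper_event x m0 th0 thm; exists U; split => // w Uw.
set eps := _ + _ + 8 * _ * _ * _.
have eps0 : 0 <= eps.
  by rewrite /eps !addr_ge0// !mulr_ge0// ?addr_ge0// ?mulr_ge0// ?invr_ge0 ltW.
have dev side i : (i < m)%N -> side_dev (ES w) side m i <= side_dev ED side m i + eps.
  move=> im; rewrite /eps (_ : 24 * K%:R = 4 * m%:R * (6 / m%:R) * K%:R); last first.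
    by field; rewrite gt_eqF.
  have s0 : 0 <= 6 / m%:R :> RR by rewrite divr_ge0// ltW.
  have pi01 := cell_mass_bounds EDexp side m.
  apply: (lowdev_perturb_smooth m0 pi01 th0 y0 s0 im).
  - move=> i' i'i; apply: le_trans s6.
    exact: (side_dev_le EDexp side (ltn_trans i'i im)).
  - by move=> j ji /=; apply: QU => //; rewrite ji.
apply: (SCDLm_le (ESexp w) m0) => [|i im].
  by have := SCDLm_ge0 ED m; lra.
have im' : (m.-1 - i < m)%N by lia.
have := SCDLm_ge EDexp im; have := dev false i im; have := dev true _ im'; lra.
Qed.

Lemma SCDLm_upper_calibrated (K : nat) (th x : RR) (m := (2 ^ K)%N) :
  0 < th -> th * m%:R <= 2^-1 -> 0 <= x -> SCDLm ED m = 0 ->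
  exists U, [/\ measurable U, (P U <= (2 * m%:R ^+ 2 * expR (1 - x))%:E)%E &
   forall w, ~ U w -> SCDLm (ES w) m <=
     2 * (2 * th + x / T%:R / th + 8 * m%:R * (x / T%:R) * K%:R)].
Proof.
move=> th0 thm x0 s0.
have m0 : (0 < m)%N by rewrite expn_gt0.
have y0 : 0 <= x / T%:R by rewrite divr_ge0.
have [U [mU PU QU]] := upper_event x m0 th0 thm; exists U; split => // w Uw.
set eps := _ + _ + 8 * _ * _ * _.
have eps0 : 0 <= eps.
  by rewrite /eps !addr_ge0// !mulr_ge0// ?invr_ge0 ltW.
have dev side i : (i < m)%N -> side_dev (ES w) side m i <= eps.
  move=> im; have pi01 := cell_mass_bounds EDexp side m.
  apply: (lowdev_perturb_calibrated (a := cell_pos ED side m) m0 pi01 th0 y0 im).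
  - move=> i' i'i; rewrite -s0.
    exact: (side_dev_le EDexp side (leq_ltn_trans i'i im)).
  - by move=> j ji /=; apply: QU => //; rewrite ji.
apply: (SCDLm_le (ESexp w) m0) => [|i im]; first by lra.
have im' : (m.-1 - i < m)%N by lia.
have := dev false i im; have := dev true _ im'; lra.
Qed.

End SampleEvents.

(** * Numerical estimates and choice of parameters *)

Lemma expR_half_le2 : expR (2^-1 : RR) <= 2.
Proof. by apply: le_trans (expR_le_quad (lexx _)) _; lra. Qed.

Lemma ln2_ge_half : 2^-1 <= ln (2 : RR).
Proof.
have <- : ln (expR (2^-1 : RR)) = 2^-1 by rewrite expRK.
by rewrite ler_ln ?posrE ?expR_gt0// expR_half_le2.
Qed.

Lemma expR1_le4 : expR (1 : RR) <= 4.
Proof.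
rewrite (_ : 1 = 2%:R * 2^-1); last by rewrite mulfV.
have h := expR_half_le2; have p := expR_ge0 (2^-1 : RR).
rewrite expRM_natl expr2; nra.
Qed.

(** With u = t^(1/4): ln t = 4 ln u <= 4(u-1) <= u^2, the last step being (u-2)^2 >= 0. *)
Lemma ln_le_sqrt (t : RR) : 1 <= t -> ln t <= Num.sqrt t.
Proof.
move=> t1; set s := Num.sqrt t; set u := Num.sqrt s.
have s0 : 0 < s by rewrite sqrtr_gt0; lra.
have u0 : 0 < u by rewrite sqrtr_gt0.
have us : s = u ^+ 2 by rewrite sqr_sqrtr// ltW.
have ut : t = u ^+ 4 by rewrite (exprM u 2 2) -us sqr_sqrtr//; lra.
have : ln (1 + (u - 1)) <= u - 1 by apply: le_ln1Dx; lra.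
rewrite addrC subrK => lnu.
rewrite [in ln t]ut lnXn// us -mulr_natr.
have := sqr_ge0 (u - 2); nra.
Qed.

Section Rates.
Variable T : nat.
Hypothesis T2 : (2 <= T)%N.
Let S : RR := Num.sqrt T%:R.
Let L : RR := ln T%:R.
Let rho : RR := Num.sqrt L.

Let TR : 2 <= T%:R :> RR. Proof. by rewrite ler_nat. Qed.

Lemma sqrt_sample_ge1 : 1 <= S.
Proof. by have t2 := TR; rewrite -[X in X <= _]sqrtr1 ler_sqrt; lra. Qed.

Lemma sqrt_sample_sqr : S ^+ 2 = T%:R.
Proof. by rewrite sqr_sqrtr. Qed.

Lemma ln_sample_ge_half : 2^-1 <= L.
Proof. by have t2 := TR; apply: le_trans ln2_ge_half _; rewrite ler_ln ?posrE//; lra. Qed.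

Lemma sqrt_ln_sqr : rho ^+ 2 = L.
Proof. by rewrite sqr_sqrtr//; have := ln_sample_ge_half; lra. Qed.

Lemma sqrt_ln_ge_half : 2^-1 <= rho.
Proof.
have L2 := ln_sample_ge_half; rewrite -[2^-1]ger0_norm ?invr_ge0// -sqrtr_sqr ler_sqrt; lra.
Qed.

Lemma ln_sample_powR : L `^ (3 / 2) = L * rho.
Proof.
have L2 := ln_sample_ge_half.
rewrite (_ : 3 / 2 = 1 + 2^-1); last by lra.
rewrite powRD; last by apply/implyP => _; rewrite gt_eqF//; lra.
by rewrite powRr1 ?powR12_sqrt//; lra.
Qed.

(** K0 is the least k with S <= mL for m = 2^(k+1). Minimality loses only one doubling, hence the
    2S; when K0 = 0 the bound is L <= S. *)
Lemma cutoff_scale : exists K0 : nat, dyadic_width K0 <= L / S /\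
  forall k, (k <= K0)%N -> (2 ^ k.+1)%:R * L <= 2 * S.
Proof.
have S1 := sqrt_sample_ge1; have L2 := ln_sample_ge_half.
have LS : L <= S by have t2 := TR; apply: ln_le_sqrt; lra.
have ex : exists k, S <= (2 ^ k.+1)%:R * L.
  exists (Num.truncn (S / L)); rewrite -ler_pdivrMr; last by lra.
  apply: ltW; apply: lt_le_trans (truncnS_gt _) _.
  by rewrite ler_nat; exact/ltnW/ltn_expl.
case: (ex_minnP ex) => K0 SK0 minK0; exists K0; split.
  have p : 0 < (2 ^ K0.+1)%:R :> RR by rewrite ltr0n expn_gt0.
  by rewrite /dyadic_width ler_pdivlMr ?ler_pdivrMl//; lra.
move=> k kK0; apply: (@le_trans _ _ ((2 ^ K0.+1)%:R * L)).
  rewrite ler_wpM2r//; first by lra.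
  by rewrite ler_nat leq_exp2l.
case: K0 SK0 minK0 {kK0} => [_ _|K0 _ minK0]; first by rewrite expn1; lra.
have : (2 ^ K0.+1)%:R * L < S.
  by rewrite ltNge; apply/negP => /minK0; rewrite ltnn.
by rewrite [in X in _ -> X]expnS natrM; lra.
Qed.

(** As L >= 1/2, m <= 4 sqrt T; taking logarithms gives k + 1 <= L + 2 <= 5L. *)
Lemma dyadic_exponent_le (k : nat) :
  (2 ^ k.+1)%:R * L <= 2 * S -> k.+1%:R <= 5 * L.
Proof.
have S1 := sqrt_sample_ge1; have L2 := ln_sample_ge_half => mL.
have t2 := TR; have S2 := sqrt_sample_sqr; have l2 := ln2_ge_half.
set m : RR := (2 ^ k.+1)%:R in mL *.
have m0 : 0 < m by rewrite ltr0n expn_gt0.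
have m4 : m <= 4 * S by nra.
have m2 : m ^+ 2 <= 2 ^+ 4 * T%:R by rewrite -S2; nra.
have : ln (m ^+ 2) <= ln (2 ^+ 4 * T%:R).
  by rewrite ler_ln ?posrE ?exprn_gt0// mulr_gt0 ?exprn_gt0//; lra.
rewrite lnM ?posrE ?exprn_gt0//; last by lra.
have -> : ln (m ^+ 2) = 2 * (k.+1%:R * ln 2).
  have mE : m = 2 ^+ k.+1 by exact: natrX.
  by rewrite lnXn// mE lnXn// mulr_natl mulr_natl.
have -> : ln (2 ^+ 4) = 4 * ln 2 :> RR by rewrite lnXn// mulr_natl.
rewrite -/L => h.
have [k2|k2] := leP k.+1%:R (2 : RR); first by lra.
have : (k.+1%:R - 2) * 2^-1 <= (k.+1%:R - 2) * ln (2 : RR).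
  by rewrite ler_wpM2l//; lra.
lra.
Qed.

(** The choice x = 2L gives e^(1-x) <= 4/T^2, while 2m^2 <= 32T; the product is 128/T, at most
    128/S. *)
Lemma event_budget (m : RR) : 1 <= m -> m * L <= 2 * S ->
  2 * m ^+ 2 * expR (1 - 2 * L) <= 128 / S /\ 2 * m * expR (1 - 2 * L) <= 128 / S.
Proof.
have S1 := sqrt_sample_ge1; have L2 := ln_sample_ge_half => m1 mL.
have t2 := TR; have S2 := sqrt_sample_sqr.
have m4 : m <= 4 * S by nra.
have e : expR (1 - 2 * L) <= 4 / S ^+ 4.
  rewrite exp.expRD exp.expRN (_ : 2 * L = L + L); last by lra.
  rewrite exp.expRD lnK ?posrE; last by lra.
  by rewrite (exprM S 2 2) S2 -expr2 ler_wpM2r ?expR1_le4.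
have e0 := expR_ge0 (1 - 2 * L).
have h1 : 2 * m ^+ 2 * expR (1 - 2 * L) <= 2 * (4 * S) ^+ 2 * (4 / S ^+ 4).
  by apply: ler_pM => //; nra.
have h2 : 2 * (4 * S) ^+ 2 * (4 / S ^+ 4) <= 128 / S.
  rewrite [leLHS](_ : _ = 128 / S * S^-1); last by field; rewrite gt_eqF//; lra.
  by rewrite ler_piMr ?invf_le1//; [rewrite divr_ge0//; lra|lra].
have h3 : 2 * m * expR (1 - 2 * L) <= 2 * m ^+ 2 * expR (1 - 2 * L).
  by rewrite ler_wpM2r//; nra.
split; lra.
Qed.

(** Of order sqrt(log T / T), which balances th against L/(T th). The 1/8 secures th m <= 1/2 at
    every scale up to the cutoff. *)
Definition bernstein_rate : RR := rho / S / 8.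

Lemma bernstein_rate_gt0 : 0 < bernstein_rate.
Proof.
have S1 := sqrt_sample_ge1; have r2 := sqrt_ln_ge_half.
by rewrite /bernstein_rate !divr_gt0//; lra.
Qed.

Lemma bernstein_rate_scale (m : RR) : m * L <= 2 * S -> bernstein_rate * m <= 2^-1.
Proof.
have S1 := sqrt_sample_ge1; have r2 := sqrt_ln_ge_half.
rewrite -sqrt_ln_sqr /bernstein_rate => mL.
have -> : rho / S / 8 * m = m * rho ^+ 2 / (8 * rho * S).
  by field; rewrite !gt_eqF//; lra.
by rewrite ler_pdivrMr; nra.
Qed.

Lemma deviation_price : 2 * L / T%:R / bernstein_rate = 16 * (rho / S).
Proof.
have S1 := sqrt_sample_ge1; have r2 := sqrt_ln_ge_half.
rewrite -sqrt_sample_sqr -sqrt_ln_sqr /bernstein_rate.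
by field; rewrite !gt_eqF//; lra.
Qed.

Lemma far_price (m K : RR) : 0 <= K -> m * L <= 2 * S -> K <= 5 * L ->
  8 * m * (2 * L / T%:R) * K <= 160 * (L / S).
Proof.
have S1 := sqrt_sample_ge1; have L2 := ln_sample_ge_half => K0 mL KL.
rewrite -sqrt_sample_sqr.
have -> : 8 * m * (2 * L / S ^+ 2) * K = 16 * (m * L) * K / S ^+ 2.
  by field; rewrite gt_eqF//; lra.
have -> : 160 * (L / S) = 16 * (2 * S) * (5 * L) / S ^+ 2.
  by field; rewrite gt_eqF//; lra.
rewrite ler_wpM2r ?invr_ge0 ?sqr_ge0//.
have h : m * L * K <= 2 * S * (5 * L).
  apply: (@le_trans _ _ (2 * S * K)); first by rewrite ler_wpM2r.
  by rewrite ler_wpM2l//; lra.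
lra.
Qed.

Lemma rates_compare : [/\ S^-1 <= 2 * (L / S), L / S <= 2 * (L * rho / S),
  rho / S <= 2 * (L / S), rho / S <= 2 * (L * rho / S) & 0 <= L * rho / S].
Proof.
have S1 := sqrt_sample_ge1; have L2 := ln_sample_ge_half; have r2 := sqrt_ln_ge_half.
have Si : 0 <= S^-1 by rewrite invr_ge0; lra.
have h1 : 0 <= S^-1 * (2 * L - 1) by rewrite mulr_ge0//; lra.
have h2 : 0 <= (L * S^-1) * (2 * rho - 1) by rewrite !mulr_ge0//; lra.
have h3 : 0 <= (rho * S^-1) * (2 * rho - 1) by rewrite !mulr_ge0//; lra.
have h4 : 0 <= (rho * S^-1) * (2 * L - 1) by rewrite !mulr_ge0//; lra.
have h5 : 0 <= L * rho * S^-1 by rewrite !mulr_ge0//; lra.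
have rL : L = rho * rho by rewrite -expr2 sqrt_ln_sqr.
have h6 : L * S^-1 = rho * rho * S^-1 by rewrite -rL.
by split; lra.
Qed.

(** The dominant terms are those where K <= 5L multiplies rho/S; the far cells cost only L/S. *)
Lemma smooth_error (m K : RR) : 0 <= K -> m * L <= 2 * S -> K <= 5 * L ->
  2 * (2 * bernstein_rate * (1 + 24 * K) + 2 * L / T%:R / bernstein_rate * (1 + K)
     + 8 * m * (2 * L / T%:R) * K) <= 1000 * (L * rho / S).
Proof.
move=> K0 mL KL; have [c1 c2 c3 c4 c5] := rates_compare.
have far := far_price K0 mL KL; have L2 := ln_sample_ge_half.
rewrite deviation_price /bernstein_rate.
have S1 := sqrt_sample_ge1; have r2 := sqrt_ln_ge_half.
have e0 : 0 <= rho / S by rewrite divr_ge0//; lra.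
have eK : rho / S * K <= 5 * (L * rho / S).
  by rewrite (_ : 5 * _ = rho / S * (5 * L)) ?ler_wpM2l//; ring.
lra.
Qed.

(** Here no factor K multiplies rho/S, so the far cells dominate and the rate is L/S. *)
Lemma calibrated_error (m K : RR) : 0 <= K -> m * L <= 2 * S -> K <= 5 * L ->
  2 * (2 * bernstein_rate + 2 * L / T%:R / bernstein_rate
     + 8 * m * (2 * L / T%:R) * K) <= 400 * (L / S).
Proof.
move=> K0 mL KL; have [c1 c2 c3 c4 c5] := rates_compare.
have far := far_price K0 mL KL; rewrite deviation_price /bernstein_rate.
have V0 : 0 <= L / S.
  by rewrite divr_ge0//; have := sqrt_sample_ge1; have := ln_sample_ge_half; lra.
lra.
Qed.

Lemma lower_error :
  2 * (2 * bernstein_rate + 2 * L / T%:R / bernstein_rate) <= 1000 * (L * rho / S).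
Proof.
have [c1 c2 c3 c4 c5] := rates_compare.
rewrite deviation_price /bernstein_rate; lra.
Qed.

End Rates.

(** * Assembly of the two expectation bounds *)

Theorem theorem1p6 :
  exists C : RR, 0 < C /\
  forall (d : measure_display) (Omega : measurableType d) (P : probability Omega RR)
         (D : probability datapt RR) (T : nat) (Z : 'I_T -> Omega -> datapt),
    (2 <= T)%N ->
    D [set z : datapt | 0 <= z.1 <= 1] = 1%E ->
    (forall j, measurable_fun setT (Z j)) ->
    (forall j (A : set datapt), measurable A -> P (Z j @^-1` A) = D A) ->
    mutually_independent P Z ->
    ((\int[P]_w (`| SCDL (Expect_emp (fun j => Z j w)) - SCDL (Expect_dist D) |)%:E)
       <= (C * (Num.sqrt T%:R)^-1 * (ln (T%:R : RR)) `^ (3 / 2))%:E)%E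
    /\
    (SCDL (Expect_dist D) = 0 ->
     ((\int[P]_w (SCDL (Expect_emp (fun j => Z j w)))%:E)
        <= (C * (Num.sqrt T%:R)^-1 * ln (T%:R : RR))%:E)%E).
Proof.
(* The first bound uses 4 + 1000 + 3072 multiples of L rho / S, the second 401 + 768 multiples of L
   / S. *)
exists 5000; split; first by rewrite ltr0n.
move=> d Omega P D T Z T2 D1 mZ lawZ indepZ.
have T0 : (0 < T)%N by exact: ltn_trans T2.
have Dexp := Expect_dist_expectation D; have Dunit := Expect_dist_unit D1.
have Sexp w := Expect_emp_expectation (fun j => Z j w) T0.
have [K0 [width scale]] := cutoff_scale T2.
have [c1 c2 c3 c4 c5] := rates_compare T2.
have L2 := ln_sample_ge_half T2; have S1 := sqrt_sample_ge1 T2.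
have Si : 0 <= 128 / Num.sqrt T%:R :> RR by rewrite divr_ge0//; lra.
have x0 : 0 <= 2 * ln (T%:R : RR) by lra.
have th0 := bernstein_rate_gt0 T2.
have m1 k : 1 <= (2 ^ k.+1)%:R :> RR by rewrite ler1n expn_gt0.
have unitE := unit_event mZ lawZ D1.
split.
  have [ku [kl [kuK klK su cmp]]] := SCDL_compare K0 Dexp Dunit.
  have upE := SCDLm_upper_smooth T0 mZ lawZ indepZ th0
    (bernstein_rate_scale T2 (scale ku kuK)) x0 su.
  have thl : 0 < bernstein_rate T <= 2^-1.
    rewrite th0; apply: le_trans (bernstein_rate_scale T2 (scale kl klK)).
    by rewrite ler_peMr// ltW.
  have lowE := lower_event T0 mZ lawZ indepZ (2 * ln T%:R)
    (_ : (0 < 2 ^ kl.+1)%N) thl.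
  (* Outside [U] the sample lies in [0,1], SCDL_m is not much too large at scale [ku], and not much
     too small at scale [kl]. On [U] the difference is at most 3. *)
  have [|U [mU PU QU]] := and_event unitE (and_event upE (lowE _)).
    by rewrite expn_gt0.
  set W := ln T%:R * Num.sqrt (ln T%:R) / Num.sqrt T%:R in c2 c4 c5.
  apply: (@le_trans _ _ ((2 * dyadic_width K0 + 1000 * W)
      + 3 * (0 + (128 / Num.sqrt T%:R + 128 / Num.sqrt T%:R)))%:E); last first.
    rewrite lee_fin ln_sample_powR// -mulrA [_^-1 * _]mulrC -/W; lra.
  apply: (integral_le_off_event mU).
  - apply: le_trans PU _; rewrite lee_fin !lerD2l lerD//.
      by have [] := event_budget T2 (m1 ku) (scale ku kuK).
    by have [] := event_budget T2 (m1 kl) (scale kl klK).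
  - have := dyadic_width_gt0 K0; lra.
  - by [].
  - move=> w; rewrite normr_ge0/=.
    have /andP[a0 a3] := SCDL_bounds (Sexp w); have /andP[b0 b3] := SCDL_bounds Dexp.
    by rewrite ler_norml; apply/andP; split; lra.
  - move=> w /QU[Sunit [up low]].
    apply: (cmp _ _ (Sexp w) Sunit).
    + by lra.
    + apply: le_trans up _; rewrite lerD2l.
      by apply: smooth_error => //; [exact: scale|exact: dyadic_exponent_le (scale ku kuK)].
    + rewrite lerBlDr; apply: le_trans low _; rewrite lerD2l.
      exact: lower_error.
move=> v0.
(* When SCDL(D) = 0 every dyadic SCDL_m(D) vanishes, so the cutoff scale can be used directly. *)
have s0 := SCDL_eq0 Dexp Dunit K0 v0.
have upE := SCDLm_upper_calibrated T0 mZ lawZ indepZ th0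
  (bernstein_rate_scale T2 (scale K0 (leqnn K0))) x0 s0.
have [U [mU PU QU]] := upE.
apply: (@le_trans _ _ ((400 * (ln T%:R / Num.sqrt T%:R) + ln T%:R / Num.sqrt T%:R)
    + 3 * (128 / Num.sqrt T%:R))%:E); last first.
  rewrite lee_fin -mulrA [_^-1 * _]mulrC; lra.
apply: (integral_le_off_event mU).
- apply: le_trans PU _; rewrite lee_fin.
  by have [] := event_budget T2 (m1 K0) (scale K0 (leqnn K0)).
- have : 0 <= ln T%:R / Num.sqrt T%:R :> RR by rewrite divr_ge0//; lra.
  lra.
- by [].
- by move=> w; exact: SCDL_bounds.
- move=> w /QU up; apply: le_trans (SCDL_le _ K0) _.
  have LS0 : 0 <= ln T%:R / Num.sqrt T%:R :> RR by rewrite divr_ge0//; lra.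
  rewrite ge_max; apply/andP; split; last by lra.
  apply: le_trans up _; apply: (@le_trans _ _ (400 * (ln T%:R / Num.sqrt T%:R))); last by lra.
  by apply: calibrated_error => //; [exact: scale|exact: dyadic_exponent_le (scale K0 (leqnn K0))].
Qed.
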